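(* For every integer $k\geq 2$ and every $\varepsilon\in\mathbb{R}$ with $0\leq\varepsilon\leq\frac{2}{(k+1)(k+2)}$, the function $f_{k,\varepsilon}:\mathbb{N}\to[0,1]$ defined by \[ f_{k,\varepsilon}(d)=\begin{cases}1 & \text{if } d=0,\\ 1-\varepsilon & \text{if } d=1,\\ \frac{2}{d+1} & \text{if } 2\leq d\leq k,\\ \min\left\{(k+1)\varepsilon,\frac{2}{d+1}\right\} & \text{if } d\geq k+1\end{cases} \] is an extremal lower bound for $\alpha_{\mathcal{C}_k}$. Furthermore, these functions completely characterize the possible lower bounds: for every integer $k\geq 2$, every lower bound for $\alpha_{\mathcal{C}_k}$ is dominated by $f_{k,\varepsilon}$ for some $\varepsilon$ with $0\leq\varepsilon\leq\frac{2}{(k+1)(k+2)}$.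
   Context: All graphs are finite, simple, and undirected; $d_G(v)$ denotes the degree of vertex $v$ in $G$; $\mathbb{N}$ includes $0$. A caterpillar is any tree that can be obtained from a path $P$ with at least one vertex by adding a (possibly empty) set of new vertices and making each new vertex adjacent to a vertex of $P$ (exactly one, since the result is a tree); a single vertex is a caterpillar. For an integer $k\geq 2$, $\mathcal{C}_k$ denotes the set of all forests of maximum degree at most $k$ every connected component of which is a caterpillar. Given a class of graphs $\mathcal{C}$ and a graph $G$, $\alpha_{\mathcal{C}}(G)$ denotes the maximum number of vertices of an induced subgraph $H$ of $G$ such that $H$ belongs to $\mathcal{C}$. A function $f:\mathbb{N}\to[0,1]$ is called a lower bound for $\alpha_{\mathcal{C}}$ if $\alpha_{\mathcal{C}}(G)\geq\sum_{v\in V(G)} f(d_G(v))$ holds for all graphs $G$. Such a lower bound $f$ is extremal if there does not exist $g:\mathbb{N}\to[0,1]$ with $g\not\equiv 0$ such that $f+g$ is also a lower bound for $\alpha_{\mathcal{C}}$. A lower bound $f$ is dominated by a lower bound $f'$ if $f(d)\leq f'(d)$ holds for every $d\in\mathbb{N}$. *)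

(* Defs.v *)
From HB Require Import structures.
From mathcomp Require Import all_boot all_order all_algebra.
From mathcomp Require Import boolp reals.

Set Implicit Arguments.
Unset Strict Implicit.
Unset Printing Implicit Defensive.

Import Order.TTheory GRing.Theory Num.Theory.

Local Open Scope ring_scope.

Record sgraph := SGraph {
  vertex :> finType;
  adj : rel vertex;
  adj_sym : symmetric adj;
  adj_irrefl : irreflexive adj
}.

Definition deg (G : sgraph) (v : G) : nat := #|[set w : G | adj v w]|.

Section Induced.
Variables (G : sgraph) (S : {set G}).

Let iadj : rel {x : G | x \in S} := fun x y => adj (val x) (val y).

Fact iadj_sym : symmetric iadj.
Proof. by move=> x y; rewrite /iadj adj_sym. Qed.

Fact iadj_irrefl : irreflexive iadj.
Proof. by move=> x; rewrite /iadj adj_irrefl. Qed.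

Definition induced : sgraph := SGraph iadj_sym iadj_irrefl.

End Induced.

(* [ucycle] also accepts the empty sequence and, for an edge xy, the sequence
   [:: x; y]; the cycles of the graph are those with at least 3 vertices. *)
Definition is_forest (G : sgraph) : Prop :=
  forall c : seq G, ucycle (@adj G) c -> (size c < 3)%N.

Definition is_connected (G : sgraph) : Prop :=
  (0 < #|G|)%N /\ forall x y : G, connect (@adj G) x y.

Definition is_tree (G : sgraph) : Prop := is_forest G /\ is_connected G.

Definition component (G : sgraph) (v : G) : {set G} :=
  [set w | connect (@adj G) v w].

Definition consecutive (T : eqType) (p : seq T) : rel T :=
  fun x y => infix [:: x; y] p || infix [:: y; x] p.

(* [p] lists the vertices of the path P in order; the vertices outside [p] are
   the added ones, and [a x] is the vertex of P to which the added vertex [x]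
   is attached.  The values of [a] on [p] are irrelevant. *)
Definition is_caterpillar (G : sgraph) : Prop :=
  is_tree G /\
  exists (p : seq G) (a : G -> G),
    [/\ p != [::],
        uniq p,
        forall x, x \notin p -> a x \in p
      & forall x y, adj x y =
          [|| consecutive p x y,
              (x \notin p) && (y == a x)
            | (y \notin p) && (x == a y)]].

Definition caterpillar_forest (k : nat) (G : sgraph) : Prop :=
  [/\ is_forest G,
      forall v : G, (deg v <= k)%N
    & forall v : G, is_caterpillar (induced (component v))].

Definition alpha (C : sgraph -> Prop) (G : sgraph) : nat :=
  \max_(S : {set G} | `[< C (induced S) >]) #|S|.

Section LowerBounds.
Variable R : realType.

Definition unit_valued (f : nat -> R) : Prop := forall d, 0 <= f d <= 1.

Definition alpha_lower_bound (C : sgraph -> Prop) (f : nat -> R) : Prop :=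
  unit_valued f /\
  forall G : sgraph, \sum_(v : G) f (deg v) <= (alpha C G)%:R.

Definition extremal_alpha_lower_bound (C : sgraph -> Prop) (f : nat -> R)
    : Prop :=
  alpha_lower_bound C f /\
  ~ exists g : nat -> R,
      [/\ unit_valued g,
          exists d, g d <> 0
        & alpha_lower_bound C (fun d => f d + g d)].

Definition dominated (f f' : nat -> R) : Prop := forall d, f d <= f' d.

Definition fkeps (k : nat) (eps : R) (d : nat) : R :=
  if d == 0%N then 1
  else if d == 1%N then 1 - eps
  else if (d <= k)%N then 2 / d.+1%:R
  else Num.min (k.+1%:R * eps) (2 / d.+1%:R).

End LowerBounds.

(* Main.v *)
Require Import Defs.
From mathcomp Require Import all_boot all_order all_algebra.
From mathcomp Require Import boolp reals.
From mathcomp Require Import ring lra zify.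

Import Order.TTheory GRing.Theory Num.Theory.

Local Open Scope ring_scope.

(** Upper side.  The complete graph on [d+1] vertices forces [h d <= 2/(d+1)] on
    every lower bound [h], because a forest inside it has at most two vertices.  A
    complete graph each of whose [n] vertices carries [k+1] pendant vertices forces
    [h d + (k+1) * h 1 <= k+1] for [d > k], because a member of the class of degree at
    most [k] misses a vertex of each of the [n] stars.  So [h] lies below [fkeps] at
    [eps = min (1 - h 1) (2/((k+1)(k+2)))].  Two of the functions [fkeps] that are
    comparable have the same [eps] (compare them at [1] and at [k+1]), which gives
    extremality as soon as they are lower bounds.

    Lower side.  Put every vertex of degree 1 (a leaf) into the solution.  A vertex
    with more than [k] leaves is thrown away: its value is at most [(k+1) * eps], and
    its leaves contribute at least that much more than they are worth.  For each other
    vertex [v], with [l] leaves, select it only if it gets at most [min 2 (k - l)]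
    selected neighbours; if the selected vertices induce an acyclic graph, then together with the leaves they form
    a forest of caterpillars of maximum degree at most [k] ([attach_leaves]).  What has
    to be paid for [v] is [f d - l * eps], and the worst [eps] is the one where the two
    terms of the minimum in [fkeps] agree.  This gives a bound [psi] without [eps] and
    [k] that depends only on the capacity 2, 1 or 0 and on the number of neighbours
    that are not leaves ([fkeps_psi]).

    It remains to find in a graph with capacities a set that induces an acyclic graph,
    respects the capacities, and has at least [sum psi] elements
    ([capped_linear_forest]).  The proof deletes vertices one by one.  Deleting [u]
    costs [psi u] and lets [psi] increase at every neighbour, by its current drop.  For
    the capacities 2 and 1 the values [2/(d+1)] and [(4/3)/(d+1)] are [d] times the
    drop, so the deletion of such a vertex is free when it has the smallest drop of
    all.  If a vertex of capacity 0 has the smallest drop [s], then deleting it may be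
    too expensive, but then its neighbours have moderate degrees, many edges leave its
    neighbourhood, and each of them is worth at least [s]; selecting the vertex and
    deleting its neighbours is therefore affordable ([reduce_cap0], whose arithmetic is
    [select_ineq]).

    This stops when all drops are at least [1/9].  Up to two easy reductions, degrees
    are then at most 3, at most 2 and 0 for the three capacities.
    The value [b] of a vertex of capacity 2 and degree 1 has been [7/9] so far.  It cannot be more in general: in a path whose ends
    have capacity 2 and whose middle has capacity 1, only two vertices can be selected,
    and [7/9 + 4/9 + 7/9 = 2].  Away from such middles it may be raised to [5/6], which
    pays for the deletion of the vertices of degree 3 ([attains_max_degree3]), and
    afterwards to [1], which settles paths and cycles ([attains_max_degree2]). *)

(** * The value of a vertex *)

Lemma natr_succ (R : comPzRingType) (d : nat) :
  ((d.+4)%:R = d%:R + 4 :> R) * ((d.+3)%:R = d%:R + 3 :> R) *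
  ((d.+2)%:R = d%:R + 2 :> R) * ((d.+1)%:R = d%:R + 1 :> R).
Proof. by do !split; rewrite ?mulrS; ring. Qed.

Lemma sum_sub_seq (T : finType) (R : numDomainType) (A : {set T}) (s : seq T) (F : T -> R) :
  (forall x, 0 <= F x) -> {subset A <= s} -> \sum_(x in A) F x <= \sum_(x <- s) F x.
Proof.
move=> F0; elim: s A => [|x s IHs] A As.
  by rewrite big_nil big1 // => y /As.
rewrite big_cons; case: (boolP (x \in A)) => xA.
  rewrite (big_setD1 x) //= lerD2l IHs // => y; rewrite !inE => /andP[/negPf yx /As].
  by rewrite inE yx.
rewrite -[X in X <= _]add0r lerD // IHs // => y yA; move: (As _ yA).
by rewrite inE => /orP[/eqP yx|//]; rewrite -yx yA in xA.
Qed.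

Section Psi.
Variable R : realFieldType.

(** The value of a vertex of capacity [c] (any [c >= 2] stands for 2) and degree [d].
    For capacities 1 and 2 it has the form [r/(d+1)], which is what makes it equal to
    [d] times its last decrement.  For capacity 0 that form would be too greedy:
    [(2/3)/(d+1)] at [d = 1], together with [b >= 7/9] at a neighbour of capacity 2 and
    degree 1, exceeds the single vertex that such an edge can contribute. *)
Definition psi (b : R) (c d : nat) : R :=
  if d == 0%N then 1
  else if c == 0%N then (2 / 3) / d.+3%:R
  else if c == 1%N then (4 / 3) / d.+1%:R
  else if d == 1%N then b else 2 / d.+1%:R.

Lemma psi_ge0 b c d : 0 <= b -> 0 <= psi b c d.
Proof.
by move=> b0; rewrite /psi; do ! case: ifP => _; rewrite ?ler01 ?divr_ge0 ?ler0n.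
Qed.

Lemma psi_le1 b c d : b <= 1 -> psi b c d <= 1.
Proof.
move=> b1; rewrite /psi; case: d => [|d] /=; first by [].
have h := ler0n R d.
by do ! case: ifP => _ //; rewrite !(natr_succ _ d) ler_pdivrMr; lra.
Qed.

Lemma ler_frac (c x y : R) : 0 <= c -> 0 < x -> x <= y -> c / y <= c / x.
Proof.
move=> c0 x0 xy; rewrite ler_wpM2l // lef_pV2 ?posrE //; exact: lt_le_trans xy.
Qed.

(** The two parameters may differ, since raising the degree costs more than any change
    of [b] within its range can gain. *)
Lemma psi_ltn b b' c d d' : 7 / 9 <= b' -> b <= 1 -> b' <= 1 ->
  (d < d')%N -> psi b c d' <= psi b' c d.
Proof.
move=> hb hb1 hb1'; case: d => [|d]; first by rewrite {2}/psi eqxx => _; exact: psi_le1.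
case: d' => // d' ; rewrite ltnS => lt.
rewrite /psi /=; case: ifP => _ /=.
  by apply: ler_frac; rewrite ?ler_nat ?ltr0n ?divr_ge0 // ltnW.
case: ifP => _ /=.
  by apply: ler_frac; rewrite ?ler_nat ?ltr0n ?divr_ge0 // ltnW.
rewrite eqSS (gtn_eqF (leq_trans _ lt)) //=.
case: d lt => [|d] /= lt; last by apply: ler_frac; rewrite ?ler_nat ?ltr0n // ltnW.
have: 3 <= d'.+2%:R :> R by rewrite ler_nat.
move: (d'.+2%:R) => x hx; rewrite ler_pdivrMr; nra.
Qed.

Lemma psi_leb b b' c d : b <= b' -> psi b c d <= psi b' c d.
Proof. by move=> bb; rewrite /psi; do ! case: ifP => _ //. Qed.

Lemma psi_leq b c d d' : 7 / 9 <= b -> b <= 1 ->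
  (d <= d')%N -> psi b c d' <= psi b c d.
Proof.
move=> h1 h2; rewrite leq_eqVlt => /orP[/eqP ->//|]; exact: psi_ltn.
Qed.

End Psi.

(** * Acyclic sets with capacities *)

Section Graph.
Variable G : sgraph.
Implicit Types (U S T W : {set G}) (x y z u v w : G) (s t : seq G).

Definition nbrs U x : {set G} := [set y in U | adj x y].
Definition degin U x : nat := #|nbrs U x|.

Lemma in_nbrs U x y : (y \in nbrs U x) = (y \in U) && adj x y.
Proof. by rewrite inE. Qed.

Lemma adjxx x : adj x x = false.
Proof. exact: adj_irrefl. Qed.

Lemma adjC x y : adj x y = adj y x.
Proof. exact: adj_sym. Qed.

Lemma nbrsS U T x : T \subset U -> nbrs T x \subset nbrs U x.
Proof.
by move=> /subsetP TU; apply/subsetP=> y; rewrite !in_nbrs => /andP[/TU ->].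
Qed.

Lemma degin_sub U T x : T \subset U -> (degin T x <= degin U x)%N.
Proof. by move=> TU; apply/subset_leq_card/nbrsS. Qed.

Lemma degin_seq_le s x : (degin [set y in s] x <= count (adj x) s)%N.
Proof.
rewrite -size_filter (leq_trans _ (card_size _)) //.
by apply/subset_leq_card/subsetP => y; rewrite in_nbrs inE mem_filter andbC.
Qed.

(** A set is acyclic when each nonempty part of it has a vertex with at most one
    neighbour in that part.  Unlike the absence of cyclic sequences, this passes
    directly to unions without edges in between and to the addition of a vertex with
    one neighbour. *)
Definition acyclic S := forall T, T \subset S -> T != set0 ->
  exists2 v, v \in T & (degin T v <= 1)%N.

Lemma acyclicS S T : T \subset S -> acyclic S -> acyclic T.
Proof. by move=> TS aS X XT; apply: aS; apply: subset_trans TS. Qed.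

Lemma acyclic_add1 S x : (degin S x <= 1)%N -> acyclic S -> acyclic (x |: S).
Proof.
move=> dx aS T TS T0; case: (boolP (x \in T)) => xT.
  exists x => //; apply: leq_trans dx; apply/subset_leq_card/subsetP => y.
  rewrite !in_nbrs => /andP[/(subsetP TS)]; rewrite in_setU1 => /orP[/eqP->|->->//].
  by rewrite adjxx.
apply: aS => //; apply/subsetP => y yT; move/(subsetP TS): (yT).
by rewrite in_setU1; case: eqP => // yx; rewrite -yx yT in xT.
Qed.

(** A list whose elements are successively leaves of what follows is a certificate of
    acyclicity that computes on explicit lists. *)
Fixpoint leafy s := if s is x :: s' then (count (adj x) s' <= 1)%N && leafy s' else true.

Lemma acyclic_leafy s : leafy s -> acyclic [set x in s].
Proof.
elim: s => [_|x s IHs /= /andP[cx /IHs aS]].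
  move=> T; rewrite set_nil subset0 => /eqP-> ; by rewrite eqxx.
have -> : [set y in x :: s] = x |: [set y in s] by apply/setP=> y; rewrite !inE.
apply: acyclic_add1 => //; exact: leq_trans (degin_seq_le _ _) cx.
Qed.

Variable cap : G -> nat.

Definition good S := (forall x, x \in S -> (degin S x <= cap x)%N) /\ acyclic S.

Lemma good0 : good set0.
Proof.
by split=> [x|T]; rewrite ?inE // subset0 => /eqP->; rewrite eqxx.
Qed.

Lemma good_seq s : all (fun x => count (adj x) s <= cap x)%N s -> leafy s ->
  good [set x in s].
Proof.
move=> /allP h l; split; last exact: acyclic_leafy.
move=> x; rewrite inE => /h; exact: leq_trans (degin_seq_le _ _).
Qed.

Lemma goodU S T : good S -> good T ->
  (forall x y, x \in S -> y \in T -> ~~ adj x y) -> good (S :|: T).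
Proof.
move=> [dS aS] [dT aT] ST.
have nS x : x \in S -> forall A : {set G}, A \subset S :|: T -> nbrs A x \subset nbrs (A :&: S) x.
  move=> xS A AST; apply/subsetP => y; rewrite !in_nbrs inE => /andP[yA xy].
  rewrite yA xy andbT; move/(subsetP AST): (yA); rewrite inE => /orP[//|yT].
  by case/negP: (ST _ _ xS yT).
have nT x : x \in T -> nbrs (S :|: T) x \subset nbrs T x.
  move=> xT; apply/subsetP => y; rewrite !in_nbrs inE => /andP[/orP[yS|yT] xy]; last by rewrite yT.
  by case/negP: (ST _ _ yS xT); rewrite adjC.
split=> [x|A AST A0].
  rewrite inE => /orP[xS|xT].
    apply: leq_trans (dS x xS); rewrite subset_leq_card //.
    by apply: subset_trans (nS _ xS _ (subxx _)) _; rewrite nbrsS ?subsetIr.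
  apply: leq_trans (dT x xT); rewrite subset_leq_card //; exact: nT.
case: (boolP (A :&: S == set0)) => [/eqP AS0|AS0].
  apply: aT => //; apply/subsetP => y yA; move/(subsetP AST): (yA).
  rewrite inE => /orP[yS|//]; have: y \in A :&: S by rewrite inE yA.
  by rewrite AS0 inE.
have [v] := aS _ (subsetIr A S) AS0; rewrite inE => /andP[vA vS] dv.
exists v => //; apply: leq_trans dv; apply/subset_leq_card; exact: nS.
Qed.

Variable R : realFieldType.
Variable b : R.
Hypothesis b_lo : 7 / 9 <= b.
Hypothesis b_hi : b <= 1.

(** The critical neighbours: a vertex of capacity 1 with two neighbours or more.  Next
    to one of them a vertex of capacity 2 and degree 1 keeps the value [7/9] even when
    [b] is larger. *)
Definition near_cap1 U x := [exists y in nbrs U x, (cap y == 1%N) && (1 < degin U y)%N].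

Definition charge U x : R := psi R (if near_cap1 U x then 7 / 9 else b) (cap x) (degin U x).

Definition total_charge U : R := \sum_(x in U) charge U x.

Lemma charge_ge0 U x : 0 <= charge U x.
Proof. move: b_lo => h; apply: psi_ge0; case: ifP => _; lra. Qed.

Lemma charge_le1 U x : charge U x <= 1.
Proof. move: b_hi => h; apply: psi_le1; case: ifP => _; lra. Qed.

(** Monotonicity is the reason for asking [1 < degin U y] and not [degin U y = 2] in
    [near_cap1]: a deletion never makes a vertex critical. *)
Lemma charge_mono U T x : T \subset U -> charge U x <= charge T x.
Proof.
move: b_lo b_hi => blo bhi TU; rewrite /charge; move: (degin_sub _ _ x TU); rewrite leq_eqVlt => /orP[/eqP->|lt].
  apply: psi_leb; case: (boolP (near_cap1 T x)) => [/existsP[y /and3P[yN cy dy]]|_].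
    have -> // : near_cap1 U x.
    apply/existsP; exists y; rewrite cy (subsetP (nbrsS _ _ _ TU)) //=.
    exact: leq_trans dy (degin_sub _ _ _ TU).
  by case: ifP => _; lra.
by apply: psi_ltn => //; case: ifP => _; lra.
Qed.

Definition gain U T x : R := charge T x - charge U x.

Lemma gain_ge0 U T x : T \subset U -> 0 <= gain U T x.
Proof. by move=> TU; rewrite subr_ge0 charge_mono. Qed.

Definition attains U := exists2 S : {set G}, S \subset U & good S /\ total_charge U <= #|S|%:R.

(** The induction step: select [s], delete [t], and continue with the rest, to which
    [s] has no edges.  The surplus [g] is what the remaining vertices gain by the
    smaller degrees. *)
Lemma reduce U s t (T := U :\: [set x in s ++ t]) (g : R) :
  uniq s -> {subset s <= U} -> good [set x in s] ->
  (forall x y, x \in s -> y \in U -> adj x y -> y \in s ++ t) ->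
  attains T ->
  g <= \sum_(x in T) gain U T x ->
  \sum_(x <- s ++ t) charge U x <= (size s)%:R + g ->
  attains U.
Proof.
move=> us sU gs cl [S ST [gS wS]] hg hsum.
exists ([set x in s] :|: S).
  apply/subUsetP; split; first by apply/subsetP=> x; rewrite inE; exact: sU.
  by apply: subset_trans ST (subsetDl _ _).
split.
  apply: goodU => // x y; rewrite inE => xs yS; apply/negP => xy.
  move/(subsetP ST): yS; rewrite !inE => /andP[/negP yn yU]; apply: yn.
  exact: cl xs yU xy.
have dis : [disjoint [set x in s] & S].
  rewrite disjoint_subset; apply/subsetP => x; rewrite !inE => xs; apply/negP.
  by move=> /(subsetP ST); rewrite !inE mem_cat xs.
rewrite cardsU (eqP (_ : #|_ :&: _| == 0%N)) ?subn0; last first.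
  by rewrite cards_eq0 setI_eq0.
rewrite natrD cardsE (card_uniqP us).
have -> : total_charge U = \sum_(x in U :&: [set x in s ++ t]) charge U x + \sum_(x in T) charge U x.
  by rewrite /total_charge (big_setID [set x in s ++ t]).
have h1 : \sum_(x in U :&: [set x in s ++ t]) charge U x <= \sum_(x <- s ++ t) charge U x.
  apply: sum_sub_seq => [x|x]; first exact: charge_ge0.
  by rewrite !inE => /andP[].
have h2 : \sum_(x in T) charge U x + g <= total_charge T.
  rewrite /total_charge -lerBrDl -sumrB; exact: hg.
lra.
Qed.

Lemma degin_split U T x : T \subset U -> degin U x = (degin T x + degin (U :\: T) x)%N.
Proof.
move=> TU; rewrite /degin -(cardsID T (nbrs U x)); congr (_ + _)%N; apply: eq_card => y.
  by rewrite !inE andbC; case: (boolP (y \in T)) => //= /(subsetP TU) ->.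
by rewrite !inE andbA.
Qed.

Lemma degin_del U u x : u \in U -> adj u x -> degin U x = (degin (U :\ u) x).+1.
Proof.
move=> uU ux; rewrite (degin_split U (U :\ u)) ?subsetDl // -addn1; congr (_ + _)%N.
rewrite -(cards1 u); apply: eq_card => y; rewrite !inE.
by case: (altP (y =P u)) => [->|] /=; rewrite ?uU ?(adjC x) ?ux //; case: (y \in U).
Qed.

(** Both sides count the edges between [T] and [U :\: T]. *)
Lemma edge_count U T : T \subset U ->
  (\sum_(x in T) (degin U x - degin T x) = \sum_(w in U :\: T) degin T w)%N.
Proof.
move=> TU.
transitivity (\sum_(x in T) \sum_(w in U :\: T | adj x w) 1)%N.
  apply: eq_bigr => x _; rewrite (degin_split U T) // addKn sum1dep_card.
  by apply: eq_card => y; rewrite !inE.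
rewrite (exchange_big_dep (mem (U :\: T))) /=; last by move=> i j _ /andP[].
apply: eq_bigr => w wU; rewrite sum1dep_card; apply: eq_card => y.
by rewrite !inE adjC; case: (y \in T); rewrite // ?andbF //= ; move: wU; rewrite inE => ->.
Qed.

Lemma reduce1 U u : u \in U -> attains (U :\ u) ->
  charge U u <= \sum_(x in nbrs U u) gain U (U :\ u) x -> attains U.
Proof.
move=> uU sol h.
have E : U :\: [set x in [::] ++ [:: u]] = U :\ u by apply/setP=> x; rewrite !inE.
apply: (reduce U [::] [:: u] (charge U u)); rewrite ?E //=.
- by rewrite set_nil; exact: good0.
- apply: le_trans h _; rewrite [X in _ <= X](big_setID (nbrs U u)) /=.
  rewrite (setIidPr _); last first.
    apply/subsetP => x; rewrite !inE => /andP[-> ux]; rewrite andbT.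
    by apply: contraTneq ux => ->; rewrite adjxx.
  by rewrite lerDl sumr_ge0 // => x _; rewrite gain_ge0 ?subsetDl.
- by rewrite big_seq1 add0r.
Qed.

End Graph.

(** * Low degrees *)

Lemma proper_ind (T : finType) (P : {set T} -> Prop) :
  (forall A : {set T}, (forall B : {set T}, B \proper A -> P B) -> P A) ->
  forall A : {set T}, P A.
Proof.
move=> h A; have [n] := ubnP #|A|; elim: n A => // n IHn A /ltnSE cA.
by apply: h => B /proper_card BA; apply: IHn; apply: leq_trans cA.
Qed.

Lemma sum_ge_card (T : finType) (R : numDomainType) (A : {set T}) (F : T -> R) c :
  (forall x, x \in A -> c <= F x) -> #|A|%:R * c <= \sum_(x in A) F x.
Proof. by move=> h; rewrite mulr_natl -sumr_const; apply: ler_sum. Qed.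

Section LowDegree.
Variable G : sgraph.
Variable cap : G -> nat.
Variable R : realFieldType.
Hypothesis cap_le2 : forall x, (cap x <= 2)%N.
Implicit Types (U S T W : {set G}) (x y z u v w : G) (s t : seq G).

Local Notation nbrs := (nbrs G).
Local Notation degin := (degin G).
Local Notation charge := (charge G cap R).
Local Notation gain := (gain G cap R).
Local Notation attains := (attains G cap R).

Lemma degin_gt0 U x y : y \in nbrs U x -> (0 < degin U x)%N.
Proof. by move=> h; apply/card_gt0P; exists y. Qed.

Lemma nbr_sym U x y : x \in U -> y \in nbrs U x -> x \in nbrs U y.
Proof. by rewrite !in_nbrs => -> /andP[_]; rewrite adjC. Qed.

Lemma degin1P U u x : degin U u = 1%N -> x \in nbrs U u -> nbrs U u = [set x].
Proof.
move=> /eqP /cards1P[z E]; by rewrite E inE => /eqP->.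
Qed.

Lemma degin2P U u x : degin U u = 2%N -> x \in nbrs U u ->
  exists2 z, z != x & nbrs U u = [set x; z].
Proof.
move=> d xN; have: #|nbrs U u :\ x| == 1%N.
  by have := cardsD1 x (nbrs U u); rewrite xN -[#|nbrs U u|]/(degin U u) d; lia.
move=> /cards1P[z E]; exists z.
  by have := set11 z; rewrite -E !inE => /andP[].
by rewrite -E setD1K.
Qed.

Lemma degin3P U u x z : degin U u = 3%N -> x \in nbrs U u -> z \in nbrs U u -> z != x ->
  exists2 w, (w != x) && (w != z) & nbrs U u = [set x; z; w].
Proof.
move=> d xN zN zx; have: #|nbrs U u :\ x :\ z| == 1%N.
  have := cardsD1 x (nbrs U u); have := cardsD1 z (nbrs U u :\ x).
  by rewrite in_setD1 zx xN zN -[#|nbrs U u|]/(degin U u) d /=; lia.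
move=> /cards1P[w E]; exists w.
  by have := set11 w; rewrite -E !inE => /andP[-> /andP[-> _]].
by rewrite -[RHS]setUA -E !setD1K // in_setD1 zx.
Qed.

Lemma psi_ge2 (b : R) c d : (2 <= d)%N -> psi R b c d <= 2 / 3.
Proof.
move=> hd; rewrite /psi; case: eqP => [|_]; first by lia.
have h : 3 <= d.+1%:R :> R by rewrite ler_nat.
have h' : 5 <= d.+3%:R :> R by rewrite ler_nat.
case: eqP => _; first by rewrite ler_pdivrMr; lra.
case: eqP => _; first by rewrite ler_pdivrMr; lra.
case: eqP => [|_]; first by lia.
by rewrite ler_pdivrMr; lra.
Qed.

Lemma psi12 (b : R) : psi R b 1 2 = 4 / 9. Proof. by rewrite /psi /=; lra. Qed.
Lemma psi11 (b : R) : psi R b 1 1 = 2 / 3. Proof. by rewrite /psi /=; lra. Qed.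
Lemma psi22 (b : R) : psi R b 2 2 = 2 / 3. Proof. by []. Qed.
Lemma psi23 (b : R) : psi R b 2 3 = 1 / 2. Proof. by rewrite /psi /=; lra. Qed.
Lemma psi21 (b : R) : psi R b 2 1 = b. Proof. by []. Qed.

Lemma psi_pos (b : R) c d : 7 / 9 <= b -> b <= 1 -> (0 < d)%N -> psi R b c d <= b.
Proof.
move=> h1 h2 hd; apply: le_trans (psi_leq R b c 1 d h1 h2 hd) _.
by rewrite /psi /=; case: eqP => _; [lra|case: eqP => _; lra].
Qed.

Lemma charge_near_cap1 b U x : near_cap1 G cap U x -> (0 < degin U x)%N -> charge b U x <= 7 / 9.
Proof. by move=> cx dx; rewrite /charge cx; apply: psi_pos => //; lra. Qed.

Lemma charge_degree2 b U x : (2 <= degin U x)%N -> charge b U x <= 2 / 3.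
Proof. exact: psi_ge2. Qed.

Lemma charge12 b U x : cap x = 1%N -> degin U x = 2%N -> charge b U x = 4 / 9.
Proof. by move=> c d; rewrite /charge c d psi12. Qed.

Lemma charge_leb b b' U x : b <= b' -> charge b U x <= charge b' U x.
Proof. by move=> bb; apply: psi_leb; case: ifP. Qed.

Lemma near_cap1P U x y : y \in nbrs U x -> cap y = 1%N -> (1 < degin U y)%N -> near_cap1 G cap U x.
Proof. by move=> h c d; apply/existsP; exists y; rewrite h c d. Qed.

(** For [n = 3] and [b = 7/9] this forces all drops to be at least [1/9]; the converse
    fails only at capacity 1 and degree 3 and at capacity 0 and degree 1. *)
Definition low_degree n U := forall x, x \in U ->
  (degin U x <= if cap x == 2 then n else if cap x == 1%N then 2 else 0)%N.

Lemma low_degreeS n U T : T \subset U -> low_degree n U -> low_degree n T.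
Proof.
by move=> TU h x /(subsetP TU)/h; apply: leq_trans; apply: degin_sub.
Qed.

Lemma low_degree_cap n U x y : low_degree n U -> x \in U -> y \in nbrs U x -> (0 < cap x)%N.
Proof.
move=> h /h + /degin_gt0; case: (cap x) => //=; lia.
Qed.

Section Red.
Variable b : R.
Hypothesis b_lo : 7 / 9 <= b.
Hypothesis b_hi : b <= 1.
Let redu := reduce G cap R b b_lo.

Lemma setD_proper U x s : x \in U -> x \in s -> U :\: [set y in s] \proper U.
Proof.
move=> xU xs; apply/properP; split; first exact: subsetDl.
by exists x => //; rewrite !inE xs.
Qed.

(** If a vertex [u] of capacity 1 and degree 2 has a neighbour [e] of degree 1, both are
    selected and the other neighbour [z] is deleted.  Since [e] and [z] are adjacent to
    [u], neither is worth more than [7/9], and [4/9 + 7/9 + 7/9 = 2]. *)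
Lemma reduce_leaf n U u e : low_degree n U ->
  (forall T, T \proper U -> attains b T) ->
  u \in U -> cap u = 1%N -> degin U u = 2%N -> e \in nbrs U u -> degin U e = 1%N ->
  attains b U.
Proof.
move=> bU IH uU cu du eN de.
have [z zx Nu] := degin2P _ _ _ du eN.
have eU : e \in U by move: eN; rewrite in_nbrs => /andP[].
have ue : adj u e by move: eN; rewrite in_nbrs => /andP[].
have uNe := nbr_sym _ _ _ uU eN.
have Ne := degin1P _ _ _ de uNe.
have ce : (0 < cap e)%N := low_degree_cap _ _ _ _ bU eU uNe.
have zN : z \in nbrs U u by rewrite Nu !inE eqxx orbT.
have zU : z \in U by move: zN; rewrite in_nbrs => /andP[].
apply: (redu U [:: u; e] [:: z] 0).
- rewrite /= andbT inE; apply/eqP => E; by rewrite E adjxx in ue.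
- by move=> x; rewrite !inE => /orP[]/eqP->.
- by apply: good_seq; rewrite /= ?(adjC G e u) ?adjxx ?ue ?cu ?ce.
- move=> x y; rewrite !inE => /orP[]/eqP-> yU xy.
    have: y \in nbrs U u by rewrite in_nbrs yU.
    by rewrite Nu !inE => /orP[]->; rewrite ?orbT.
  have: y \in nbrs U e by rewrite in_nbrs yU.
  by rewrite Ne !inE => ->.
- by apply: IH; apply: (setD_proper _ u); rewrite ?inE ?eqxx.
- by apply: sumr_ge0 => x _; apply: gain_ge0 => //; exact: subsetDl.
have H1 : charge b U e <= 7 / 9 by apply: charge_near_cap1; rewrite ?de //; apply: (near_cap1P _ _ u); rewrite ?du.
have H2 : charge b U z <= 7 / 9.
  have uz := nbr_sym _ _ _ uU zN.
  by apply: charge_near_cap1; [apply: (near_cap1P _ _ u); rewrite ?du|exact: degin_gt0 uz].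
have H3 := charge12 b _ _ cu du.
rewrite /= !big_cons big_nil; lra.
Qed.

End Red.

(** With degrees at most 2 a vertex of capacity 2 and degree 1 may have the value 1 away
    from the vertices of capacity 1 and degree 2.  The latter are removed first; each of
    them costs [4/9], and a neighbour usually gains at least [2/9].  The exception is a
    neighbour [y] of capacity 2 between two such vertices [u] and [u1]: then [u], [y] and
    [u1] are selected together.  Afterwards a vertex on a cycle costs [2/3] and both its
    neighbours gain [1/3]. *)
Lemma attains_max_degree2 U : low_degree 2 U -> attains 1 U.
Proof.
have b1 : 7 / 9 <= 1 :> R by lra.
have b2 : (1 : R) <= 1 by [].
elim/proper_ind: U => U IH bU.
have {}IH T : T \proper U -> attains 1 T.
  by move=> TU; apply: IH => //; apply: low_degreeS bU; apply: proper_sub.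
have pD x : x \in U -> U :\ x \proper U by move=> xU; apply: properD1.
have inN x y : (y \in nbrs U x) -> [/\ y \in U & adj x y].
  by rewrite in_nbrs => /andP[].
case: (pselect (exists u e, [/\ u \in U, cap u = 1%N, degin U u = 2%N, e \in nbrs U u & degin U e = 1%N])).
  move=> [u [e [h1 h2 h3 h4 h5]]]; exact: (reduce_leaf 1 b1 b2 2 U u e).
move=> no_leaf.
have deg2 u e : u \in U -> cap u = 1%N -> degin U u = 2%N -> e \in nbrs U u -> degin U e = 2%N.
  move=> uU cu du eN; have [eU _] := inN _ _ eN.
  have h1 := degin_gt0 _ _ _ (nbr_sym _ _ _ uU eN).
  have h2 := bU _ eU; have h3 := low_degree_cap _ _ _ _ bU eU (nbr_sym _ _ _ uU eN).
  have h4 : degin U e != 1%N by apply/eqP => de; apply: no_leaf; exists u, e.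
  by move: h2; do 2? case: ifP => _; lia.
case: (pselect (exists u, [/\ u \in U, cap u = 1%N & degin U u = 2%N])).
  move=> [u [uU cu du]].
  case: (pselect (exists y u1, [/\ y \in nbrs U u, cap y = 2%N, u1 \in nbrs U y, u1 != u & cap u1 = 1%N /\ degin U u1 = 2%N])).
    move=> [y [u1 [yN cy u1N u1u [cu1 du1]]]].
    have [yU uy] := inN _ _ yN; have [u1U yu1] := inN _ _ u1N.
    have dy := deg2 _ _ uU cu du yN.
    have uNy := nbr_sym _ _ _ uU yN.
    have [y2 y2y Nu] := degin2P _ _ _ du yN.
    have Ny : nbrs U y = [set u; u1].
      have [z zx E] := degin2P _ _ _ dy uNy; move: u1N; rewrite E !inE (negPf u1u) /=.
      by move=> /eqP->.
    have [y3 y3y Nu1] := degin2P _ _ _ du1 (nbr_sym _ _ _ yU u1N).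
    have clu x : x \in U -> adj u x -> (x == y) || (x == y2).
      by move=> xU ux; have: x \in nbrs U u by [rewrite in_nbrs xU]; rewrite Nu !inE.
    have cly x : x \in U -> adj y x -> (x == u) || (x == u1).
      by move=> xU ux; have: x \in nbrs U y by [rewrite in_nbrs xU]; rewrite Ny !inE.
    have clu1 x : x \in U -> adj u1 x -> (x == y) || (x == y3).
      by move=> xU ux; have: x \in nbrs U u1 by [rewrite in_nbrs xU]; rewrite Nu1 !inE.
    have vu := charge12 1 _ _ cu du; have vu1 := charge12 1 _ _ cu1 du1.
    have vy := charge_degree2 1 U y (eq_leq (esym dy)).
    case: (boolP (adj u u1)) => uu1.
      (* [u], [y], [u1] form a triangle *)
      apply: (reduce G cap R 1 b1 U [:: u; y] [:: u1] 0).
      - by rewrite /= andbT inE; apply/eqP => E; rewrite E adjxx in uy.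
      - by move=> x; rewrite !inE => /orP[]/eqP->.
      - by apply: good_seq; rewrite /= ?(adjC G y u) ?adjxx ?uy ?cu ?cy.
      - move=> x z; rewrite !inE => /orP[]/eqP-> zU xz.
          have h := clu _ zU xz; have /orP[/eqP E|/eqP E] := clu _ u1U uu1.
            by rewrite E adjxx in yu1.
          by rewrite -E in h; case/orP: h => ->; rewrite ?orbT.
        by have /orP[->|->] := cly _ zU xz; rewrite ?orbT.
      - by apply: IH; apply: (setD_proper _ u); rewrite ?inE ?eqxx.
      - by apply: sumr_ge0 => x _; apply: gain_ge0 => //; exact: subsetDl.
      rewrite /= !big_cons big_nil; lra.
    have y2N : y2 \in nbrs U u by rewrite Nu !inE eqxx orbT.
    have y3N : y3 \in nbrs U u1 by rewrite Nu1 !inE eqxx orbT.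
    have vy2 := charge_degree2 1 U y2 (eq_leq (esym (deg2 _ _ uU cu du y2N))).
    have vy3 := charge_degree2 1 U y3 (eq_leq (esym (deg2 _ _ u1U cu1 du1 y3N))).
    apply: (reduce G cap R 1 b1 U [:: u; y; u1] [:: y2; y3] 0).
    - have yu1' : y != u1 by apply: contraTneq yu1 => ->; rewrite adjxx.
      have uy' : u != y by apply: contraTneq uy => ->; rewrite adjxx.
      by rewrite /= !inE negb_or uy' yu1' [u == u1]eq_sym u1u.
    - by move=> x; rewrite !inE => /orP[|/orP[]]/eqP->.
    - apply: good_seq; rewrite /= ?(adjC G y u) ?(adjC G u1 y) ?(adjC G u1 u) ?adjxx ?uy ?yu1 ?(negPf uu1) ?cu ?cy ?cu1 //.
    - move=> x z; rewrite !inE => /orP[|/orP[]]/eqP-> zU xz.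
      + by have /orP[->|->] := clu _ zU xz; rewrite ?orbT.
      + by have /orP[->|->] := cly _ zU xz; rewrite ?orbT.
      + by have /orP[->|->] := clu1 _ zU xz; rewrite ?orbT.
    - by apply: IH; apply: (setD_proper _ u); rewrite ?inE ?eqxx.
    - by apply: sumr_ge0 => x _; apply: gain_ge0 => //; exact: subsetDl.
    rewrite /= !big_cons big_nil; lra.
  move=> no_alt; apply: (reduce1 G cap R 1 b1 b2 U u) => //; first exact: IH (pD _ uU).
  apply: le_trans (_ : #|nbrs U u|%:R * (2 / 9) <= _); last first.
    apply: sum_ge_card => y yN; have [yU uy] := inN _ _ yN.
    have dy := deg2 _ _ uU cu du yN.
    have dy' : degin (U :\ u) y = 1%N by move: dy; rewrite (degin_del G U u y) // => -[].
    have cy := low_degree_cap _ _ _ _ bU yU (nbr_sym _ _ _ uU yN).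
    rewrite /gain /charge dy dy'; have := cap_le2 y.
    have [cy1|cy1] : cap y = 1%N \/ cap y = 2%N by have := cap_le2 y; lia.
      by rewrite cy1 psi11 psi12; lra.
    rewrite cy1 psi21 psi22; case: ifP => [/existsP[w /and3P[wN /eqP cw dw]]|_]; last by lra.
    have [wT yw] : w \in U :\ u /\ adj y w by move: wN; rewrite in_nbrs => /andP[].
    move: wT; rewrite !inE => /andP[wu wU].
    case: no_alt; exists y, w; split => //; first by rewrite in_nbrs wU.
    split=> //; have := bU _ wU; rewrite cw /= => dw2; apply/eqP.
    by rewrite eqn_leq dw2 (leq_trans dw) // degin_sub ?subsetDl.
  rewrite (charge12 1 _ _ cu du) -[#|_|]/(degin U u) du; lra.
move=> no12.
case: (pselect (acyclic G U)) => [aU|naU].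
  exists U => //; split.
    split=> // x xU; have := bU _ xU; case: eqP => [->//|c2]; case: eqP => [c1|c0]; last by lia.
    rewrite c1; have h : degin U x != 2%N by apply/eqP => dx; apply: no12; exists x.
    lia.
  rewrite /total_charge -sum1_card natr_sum; apply: ler_sum => x _; exact: charge_le1.
(* A part in which all degrees are at least 2 takes over the role of a cycle. *)
have [T [TU /set0Pn[v vT] hT]] : exists T, [/\ T \subset U, T != set0 & forall v, v \in T -> (2 <= degin T v)%N].
  apply: contrapT => h; apply: naU => T TU T0; apply: contrapT => h2; apply: h; exists T; split=> // v vT.
  by rewrite ltnNge; apply/negP => dv; apply: h2; exists v.
have N2 x : x \in T -> cap x = 2%N /\ degin U x = 2%N.
  move=> xT; have xU := subsetP TU _ xT; have := hT _ xT; have := degin_sub G U T x TU.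
  have := bU _ xU; case: eqP => [->|c2]; first by lia.
  case: eqP => [c1|c0]; last by lia.
  move=> h1 h2 h3; case: no12; exists x; split=> //; lia.
have vU := subsetP TU _ vT; have [cv dv] := N2 _ vT.
apply: (reduce1 G cap R 1 b1 b2 U v) => //; first exact: IH (pD _ vU).
have Nv : nbrs T v = nbrs U v.
  by apply/eqP; rewrite eqEcard nbrsS //= -[#|_|]/(degin U v) dv; exact: hT.
apply: le_trans (_ : #|nbrs U v|%:R * (1 / 3) <= _); last first.
  apply: sum_ge_card => y yN; have [yU vy] := inN _ _ yN.
  have yT : y \in T by move: yN; rewrite -Nv in_nbrs => /andP[].
  have [cy dy] := N2 _ yT.
  have dy' : degin (U :\ v) y = 1%N by move: dy; rewrite (degin_del G U v y) // => -[].
  rewrite /gain /charge dy dy' cy psi21 psi22; case: ifP => [/existsP[w /and3P[wN /eqP cw dw]]|_]; last by lra.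
  have [wT yw] : w \in U :\ v /\ adj y w by move: wN; rewrite in_nbrs => /andP[].
  move: wT; rewrite !inE => /andP[wu wU].
  case: no12; exists w; split => //; have := bU _ wU; rewrite cw /= => dw2; apply/eqP.
  by rewrite eqn_leq dw2 (leq_trans dw) // degin_sub ?subsetDl.
rewrite /charge cv dv psi22 -[#|_|]/(degin U v) dv; lra.
Qed.

End LowDegree.

Section LowDegree3.
Variable G : sgraph.
Variable cap : G -> nat.
Variable R : realFieldType.
Hypothesis cap_le2 : forall x, (cap x <= 2)%N.
Implicit Types (U S T W : {set G}) (x y z u v w : G) (s t : seq G).

Local Notation nbrs := (nbrs G).
Local Notation degin := (degin G).
Local Notation charge := (charge G cap R).
Local Notation gain := (gain G cap R).
Local Notation attains := (attains G cap R).
Local Notation low_degree := (low_degree G cap).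

(** When [b <= 5/6] no step of the value is below [1/9], so that each lost edge counts. *)
Lemma gain_edge b n U T x : 7 / 9 <= b -> b <= 5 / 6 -> low_degree n U -> (n <= 3)%N ->
  T \subset U -> x \in U ->
  1 / 9 * (degin U x - degin T x)%:R <= gain b U T x.
Proof.
move=> b1 b2 bU n3 TU xU; have := degin_sub G U T x TU; have := bU x xU; have := cap_le2 x.
have bhi : b <= 1 by lra.
have := gain_ge0 G cap R b b1 bhi U T x TU.
rewrite /gain /charge; set bT := (X in psi _ X _ (degin T x)); set bU' := (X in psi _ X _ (degin U x)).
have hT : 7 / 9 <= bT by rewrite /bT; case: ifP => _; lra.
have hU : bU' <= 5 / 6 by rewrite /bU'; case: ifP => _; lra.
clearbody bT bU'; move: (cap x) (degin U x) (degin T x) => c dU dT.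
clear - b1 b2 n3 hT hU => g0 hc hdU hdT.
have [E|lt] := eqVneq dT dU.
  by rewrite (_ : (dU - dT)%N = 0%N) ?mulr0 // E subnn.
case: c hc hdU g0 => [|[|[|//]]] _ /= hdU.
- by move: hdU hdT lt; rewrite leqn0 => /eqP->; rewrite leqn0 => /eqP->; rewrite eqxx.
- case: dU hdU hdT lt => [|[|[|//]]] _; case: dT => [|[|[|//]]] //= _ _ _; rewrite ?subSS ?subn0 /psi /=; lra.
have {}hdU := leq_trans hdU n3.
case: dU hdU hdT lt => [|[|[|[|//]]]] _; case: dT => [|[|[|[|//]]]] //= _ _ _; rewrite ?subSS ?subn0 /psi /=; lra.
Qed.

Lemma gain_lost b c U s v z (T := U :\: [set x in s]) : 0 <= c ->
  (forall x, x \in T -> c * (degin U x - degin T x)%:R <= gain b U T x) ->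
  v != z -> v \in s -> z \in s -> v \in U -> z \in U ->
  c * (degin U v - count (adj v) s + (degin U z - count (adj z) s))%:R
    <= \sum_(x in T) gain b U T x.
Proof.
move=> c0 h vz vs zs vU zU.
have TU : T \subset U := subsetDl _ _.
apply: le_trans (ler_sum _ h); rewrite -mulr_sumr ler_wpM2l // -natr_sum ler_nat.
rewrite (edge_count G U T TU).
have UT : U :\: T = U :&: [set x in s].
  by apply/setP=> x; rewrite !inE; case: (x \in U); rewrite ?andbF ?andbT ?negbK.
have low w : (degin U w - count (adj w) s <= degin T w)%N.
  rewrite (degin_split G U T w TU) UT leq_subLR addnC leq_add2r.
  by apply: leq_trans (degin_seq_le G s w); apply: degin_sub; apply: subsetIr.
rewrite UT (big_setD1 v) ?inE ?vU //= (big_setD1 z) /=; last by rewrite !inE eq_sym vz zU.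
by rewrite addnA; apply: leq_trans (leq_addr _ _); apply: leq_add; apply: low.
Qed.

(** A vertex [v] of capacity 2 and degree 3 costs [1/2], and with [b = 5/6] each of its
    neighbours gains [1/6], except a neighbour [x] of capacity 2 and degree 2 whose other
    neighbour [u] is critical.  In that case [x] and [u] are selected, and [v] and the
    other neighbour [z] of [u] are deleted (possibly [z = v]); the lost edges at [v] and [z] pay for it
    unless [v], [x], [u], [z] is a 4-cycle with [z] of capacity 2 and degree 2. *)
Lemma attains_max_degree3 U : low_degree 3 U -> attains (5 / 6) U.
Proof.
have b1 : 7 / 9 <= 5 / 6 :> R by lra.
have b2 : 5 / 6 <= 1 :> R by lra.
have b3 : 5 / 6 <= 5 / 6 :> R by [].
elim/proper_ind: U => U IH bU.
have {}IH T : T \proper U -> attains (5 / 6) T.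
  by move=> TU; apply: IH => //; apply: low_degreeS bU; apply: proper_sub.
have pD x : x \in U -> U :\ x \proper U by move=> xU; apply: properD1.
have inN x y : (y \in nbrs U x) -> [/\ y \in U & adj x y].
  by rewrite in_nbrs => /andP[].
have neq x y : adj x y -> x != y by apply: contraTneq => ->; rewrite adjxx.
case: (pselect (exists u e, [/\ u \in U, cap u = 1%N, degin U u = 2%N, e \in nbrs U u & degin U e = 1%N])).
  move=> [u [e [h1 h2 h3 h4 h5]]]; exact: (reduce_leaf G cap R (5 / 6) b1 b2 3 U u e).
move=> no_leaf.
have capB w : w \in U -> cap w = 1%N -> (degin U w <= 2)%N by move=> /bU + cw; rewrite cw.
have capN w : w \in U -> (degin U w <= 3)%N.
  by move=> /bU h; apply: leq_trans h _; do 2? case: ifP.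
case: (pselect (exists v, [/\ v \in U, cap v = 2%N & degin U v = 3%N])); last first.
  move=> no23; have b2U : low_degree 2 U.
    move=> x xU; have := bU _ xU; case: eqP => [cx|//] dx.
    rewrite leqNgt; apply/negP => dx3; apply: no23; exists x; split=> //.
    by apply/eqP; rewrite eqn_leq dx dx3.
  have [S SU [gS wS]] := attains_max_degree2 G cap R cap_le2 U b2U.
  exists S => //; split=> //; apply: le_trans wS; apply: ler_sum => x _.
  exact: charge_leb.
move=> [v [vU cv dv]].
case: (pselect (exists x u, [/\ x \in nbrs U v, cap x = 2%N, degin U x = 2%N, u \in nbrs U x & cap u = 1%N /\ degin U u = 2%N])); last first.
  move=> no_pair; apply: (reduce1 G cap R (5 / 6) b1 b2 U v) => //; first exact: IH (pD _ vU).
  apply: le_trans (_ : #|nbrs U v|%:R * (1 / 6) <= _); last first.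
    apply: sum_ge_card => y yN; have [yU vy] := inN _ _ yN.
    have vNy := nbr_sym G _ _ _ vU yN.
    have d0 := degin_gt0 G _ _ _ vNy; have dE := degin_del G U v y vU vy.
    have cy := low_degree_cap G cap _ _ _ _ bU yU vNy; have cy2 := cap_le2 y.
    have not_near : cap y = 2%N -> degin U y = 2%N -> ~~ near_cap1 G cap (U :\ v) y.
      move=> cy1 dy; apply/existsP => -[w /and3P[wN /eqP cw dw]].
      move: wN; rewrite in_nbrs !inE => /andP[/andP[wv wU] yw].
      apply: no_pair; exists y, w; split=> //; first by rewrite in_nbrs wU.
      split=> //; apply/eqP; rewrite eqn_leq capB // (leq_trans dw) // degin_sub ?subsetDl //.
    have h3 := capN _ yU; have h2 := capB _ yU.
    rewrite /gain /charge; set bU' := (X in psi _ X _ (degin U y)).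
    have hU : bU' <= 5 / 6 by rewrite /bU'; case: ifP => _; lra.
    move: not_near h3 h2 cy2 cy; case: (near_cap1 _ _ _ _) => /=; move: dE d0; clearbody bU'; clear - hU.
      move: (cap y) (degin U y) (degin (U :\ v) y) => c d d' -> _ not_near h3 h2 c2 c1.
      case: c c1 c2 h2 not_near => [|[|[|//]]] // _ _ h2 not_near.
        have {}h2 := h2 erefl; case: d' h3 h2 not_near => [|[|//]] _ _ _; rewrite /psi /=; lra.
      case: d' h3 {h2} not_near => [|[|[|//]]] _ not_near; first by rewrite /psi /=; lra.
        by have := not_near erefl erefl.
      by rewrite /psi /=; lra.
    move: (cap y) (degin U y) (degin (U :\ v) y) => c d d' -> _ _ h3 h2 c2 c1.
    case: c c1 c2 h2 => [|[|[|//]]] // _ _ h2.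
      have {}h2 := h2 erefl; case: d' h3 h2 => [|[|//]] _ _; rewrite /psi /=; lra.
    by case: d' h3 {h2} => [|[|[|//]]] _; rewrite /psi /=; lra.
  rewrite /charge cv dv psi23 -[#|_|]/(degin U v) dv; lra.
move=> [x [u [xN cx dx uN [cu du]]]].
have [xU vx] := inN _ _ xN; have [uU xu] := inN _ _ uN.
have vNx := nbr_sym G _ _ _ vU xN; have xNu := nbr_sym G _ _ _ xU uN.
have uv : u != v by apply/eqP => E; rewrite E cv in cu.
have Nx : nbrs U x = [set v; u].
  have [z zv E] := degin2P G _ _ _ dx vNx; move: uN; rewrite E !inE (negPf uv) /=.
  by move=> /eqP->.
have [z zx Nu] := degin2P G _ _ _ du xNu.
have zN : z \in nbrs U u by rewrite Nu !inE eqxx orbT.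
have [zU uz] := inN _ _ zN.
have cl w A y : nbrs U w = A -> y \in U -> adj w y -> y \in A.
  by move=> <- yU wy; rewrite in_nbrs yU.
have adjE w A y : nbrs U w = A -> y \in U -> adj w y = (y \in A).
  by move=> <- yU; rewrite in_nbrs yU.
have wx : charge (5 / 6) U x = 2 / 3 by rewrite /charge cx dx psi22.
have wu := charge12 G cap R (5 / 6) _ _ cu du.
have wv : charge (5 / 6) U v = 1 / 2 by rewrite /charge cv dv psi23.
have xu' := neq _ _ xu; have vx' := neq _ _ vx; have uz' := neq _ _ uz.
have [zv|zv] := eqVneq z v.
  apply: (reduce G cap R (5 / 6) b1 U [:: x; u] [:: v] 0).
  - by rewrite /= !inE xu'.
  - by move=> y; rewrite !inE => /orP[]/eqP->.
  - by apply: good_seq; rewrite /= ?(adjC G u x) ?adjxx ?xu ?cu ?cx.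
  - move=> y w; rewrite !inE => /orP[]/eqP-> wU yw.
      by have := cl _ _ _ Nx wU yw; rewrite !inE => /orP[]->; rewrite ?orbT.
    by have := cl _ _ _ Nu wU yw; rewrite zv !inE => /orP[]->; rewrite ?orbT.
  - by apply: IH; apply: (setD_proper G _ u); rewrite ?inE ?eqxx ?orbT.
  - by apply: sumr_ge0 => y _; apply: gain_ge0 => //; exact: subsetDl.
  by rewrite /= !big_cons big_nil wx wu wv; lra.
have vu0 : adj v u = false by rewrite adjC (adjE _ _ _ Nu vU) !inE (negPf vx') eq_sym (negPf zv).
have xz0 : adj x z = false by rewrite (adjE _ _ _ Nx zU) !inE (negPf zv) eq_sym (negPf uz').
have uNz := nbr_sym G _ _ _ uU zN.
have dz1 : (1 < degin U z)%N.
  have d0 := degin_gt0 G _ _ _ uNz; rewrite ltn_neqAle d0 andbT; apply/eqP => E.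
  by apply: no_leaf; exists u, z.
have cz0 := low_degree_cap G cap _ _ _ _ bU zU uNz.
(* [g] counts the edges from [v] and [z] to the remaining vertices.  The worst case has
   [z] of capacity 2 and degree 2, where three such edges face a deficit of [5/18]. *)
have general : adj v z = false \/ cap z = 1%N \/ degin U z = 3%N -> attains (5 / 6) U.
  move=> cond.
  pose s := [:: x; u; v; z].
  pose g : R := 1 / 9 * (degin U v - count (adj v) s + (degin U z - count (adj z) s))%:R.
  apply: (reduce G cap R (5 / 6) b1 U [:: x; u] [:: v; z] g).
  - by rewrite /= !inE xu'.
  - by move=> y; rewrite !inE => /orP[]/eqP->.
  - by apply: good_seq; rewrite /= ?(adjC G u x) ?adjxx ?xu ?cu ?cx.
  - move=> y w; rewrite !inE => /orP[]/eqP-> wU yw.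
      by have := cl _ _ _ Nx wU yw; rewrite !inE => /orP[]->; rewrite ?orbT.
    by have := cl _ _ _ Nu wU yw; rewrite !inE => /orP[]->; rewrite ?orbT.
  - by apply: IH; apply: (setD_proper G _ u); rewrite ?inE ?eqxx ?orbT.
  - apply: (gain_lost (5 / 6) (1 / 9) U s v z); rewrite ?inE ?eqxx ?orbT //.
    + by rewrite divr_ge0.
    + by move=> w; rewrite inE => /andP[_ wU]; apply: (gain_edge _ 3) => //; apply: subsetDl.
    + by rewrite eq_sym.
  rewrite /= !big_cons big_nil wx wu wv /g /s /= vx vu0 !adjxx [adj z x]adjC xz0.
  rewrite [adj z u]adjC uz [adj z v]adjC dv /charge.
  have h3 := capN _ zU; have h2 := capB _ zU; have c2 := cap_le2 z.
  move: (if _ then _ else _) => b'.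
  clear - cz0 dz1 cond h3 h2 c2.
  move: (cap z) (degin U z) (adj v z) cz0 dz1 cond h3 h2 c2 => c d a.
  case: c => [|[|[|//]]] // _; case: d => [|[|[|[|//]]]] // _; case: a => -[//|[//|]] // _;
    rewrite ?subSS ?subn0 /psi /= => h3 h2 _; (try by have := h2 erefl); lra.
case: (boolP (adj v z)) => [vz|/negPf vz]; last exact: (general (or_introl vz)).
have [cz|cz] : cap z = 1%N \/ cap z = 2%N by have := cap_le2 z; case: (cap z) cz0 => [|[|[|//]]] //; [left|right].
  exact: (general (or_intror (or_introl cz))).
have [dz|dz] : degin U z = 3%N \/ degin U z = 2%N.
  by have := capN _ zU; case: (degin U z) dz1 => [|[|[|[|//]]]] //; [right|left].
  exact: (general (or_intror (or_intror dz))).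
(* The 4-cycle [v], [x], [u], [z]: the third neighbour [w] of [v] decides.  If it has
   capacity 2 and degree 1, the path [w], [v], [x], [u] is selected, which leaves only [z]
   to delete; otherwise [w] is worth at most [2/3] and is deleted together with [u]. *)
have zNv : z \in nbrs U v by rewrite in_nbrs zU.
have [w /andP[wx' wz'] Nv] := degin3P G _ _ _ _ dv xN zNv zx.
have wN : w \in nbrs U v by rewrite Nv !inE eqxx !orbT.
have [wU vw] := inN _ _ wN.
have vNz := nbr_sym G _ _ _ vU zNv.
have Nz : nbrs U z = [set v; u].
  have [y yv E] := degin2P G _ _ _ dz vNz; move: uNz; rewrite E !inE (negPf uv) /=.
  by move=> /eqP->.
have uw0 : adj u w = false by rewrite (adjE _ _ _ Nu wU) !inE (negPf wx') (negPf wz').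
have vw' := neq _ _ vw.
have uw' : u != w by apply: contraTneq vw => <-; rewrite vu0.
have xw0 : adj x w = false by rewrite (adjE _ _ _ Nx wU) !inE ![w == _]eq_sym (negPf vw') (negPf uw').
have wz : charge (5 / 6) U z = 2 / 3 by rewrite /charge cz dz psi22.
have vz' := neq _ _ vz.
have [/andP[/eqP cw /eqP dw]|cdw] := boolP ((cap w == 2%N) && (degin U w == 1%N)).
  have Nw : nbrs U w = [set v] by apply: degin1P dw _; apply: nbr_sym.
  apply: (reduce G cap R (5 / 6) b1 U [:: w; v; x; u] [:: z] 0).
  - by rewrite /= !inE xu' [w == v]eq_sym [w == u]eq_sym [v == u]eq_sym !negb_or vw' wx' uw' vx' uv.
  - by move=> y; rewrite !inE => /orP[|/orP[|/orP[]]]/eqP->.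
  - by apply: good_seq; rewrite /= ?(adjC G w) ?(adjC G u x) ?(adjC G u v) ?(adjC G x v) ?adjxx ?xu ?vx ?vw ?vu0 ?xw0 ?uw0 ?cu ?cx ?cv ?cw.
  - move=> y t; rewrite !inE => /orP[|/orP[|/orP[]]]/eqP-> tU yt.
    + by have := cl _ _ _ Nw tU yt; rewrite !inE => ->; rewrite ?orbT.
    + by have := cl _ _ _ Nv tU yt; rewrite !inE => /orP[/orP[]|]->; rewrite ?orbT.
    + by have := cl _ _ _ Nx tU yt; rewrite !inE => /orP[]->; rewrite ?orbT.
    + by have := cl _ _ _ Nu tU yt; rewrite !inE => /orP[]->; rewrite ?orbT.
  - by apply: IH; apply: (setD_proper G _ u); rewrite ?inE ?eqxx ?orbT.
  - by apply: sumr_ge0 => y _; apply: gain_ge0 => //; exact: subsetDl.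
  have := charge_le1 G cap R (5 / 6) b2 U w.
  by rewrite /= !big_cons big_nil wx wu wv wz; clear - R; lra.
have ww : charge (5 / 6) U w <= 2 / 3.
  have d0 := degin_gt0 G _ _ _ (nbr_sym G _ _ _ vU wN).
  have [d1|d1] := ltnP 1 (degin U w); first exact: charge_degree2.
  have dw : degin U w = 1%N by apply/eqP; rewrite eqn_leq d0 d1.
  have cw0 := low_degree_cap G cap _ _ _ _ bU wU (nbr_sym G _ _ _ vU wN).
  have cw : cap w = 1%N.
    move: cdw cw0; rewrite dw eqxx andbT; have := cap_le2 w.
    by case: (cap w) => [|[|[|]]].
  by rewrite /charge cw dw psi11.
apply: (reduce G cap R (5 / 6) b1 U [:: x; v; z] [:: u; w] 0).
- by rewrite /= !inE negb_or [x == v]eq_sym [x == z]eq_sym vx' zx vz'.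
- by move=> y; rewrite !inE => /orP[|/orP[]]/eqP->.
- by apply: good_seq; rewrite /= ?(adjC G z) ?(adjC G x v) ?adjxx ?vx ?vz ?xz0 ?cx ?cv ?cz.
- move=> y t; rewrite !inE => /orP[|/orP[]]/eqP-> tU yt.
  + by have := cl _ _ _ Nx tU yt; rewrite !inE => /orP[]->; rewrite ?orbT.
  + by have := cl _ _ _ Nv tU yt; rewrite !inE => /orP[/orP[]|]->; rewrite ?orbT.
  + by have := cl _ _ _ Nz tU yt; rewrite !inE => /orP[]->; rewrite ?orbT.
- by apply: IH; apply: (setD_proper G _ x); rewrite ?inE ?eqxx ?orbT.
- by apply: sumr_ge0 => y _; apply: gain_ge0 => //; exact: subsetDl.
by rewrite /= !big_cons big_nil wx wu wv wz; move: ww; clear - R; lra.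
Qed.

End LowDegree3.

(** * The decrements of the value *)

Ltac nneg := match goal with
  | |- is_true (0 <= _ + _) => apply: addr_ge0; nneg
  | |- is_true (0 <= _ / _) => apply: divr_ge0; nneg
  | |- is_true (0 <= _ * _) => apply: mulr_ge0; nneg
  | |- is_true (0 <= _ ^+ 2) => exact: sqr_ge0
  | |- is_true (0 <= _ ^+ _) => apply: exprn_ge0; nneg
  | |- is_true (0 <= _%:R) => exact: ler0n
  | |- is_true (0 <= 1) => exact: ler01
  | |- _ => assumption
  end.

Section Drops.
Variable R : realFieldType.
Local Notation psi0 := (psi R (7 / 9)).

Definition psi_drop (c D : nat) : R := psi0 c D.-1 - psi0 c D.

Lemma drop_cap0 D : (2 <= D)%N -> psi_drop 0 D = (2 / 3) / ((D%:R + 2) * (D%:R + 3)).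
Proof.
case: D => [|[|d]] // _; rewrite /psi_drop /psi /=; have h := ler0n R d.
rewrite !(natr_succ _ d.+1) !(natr_succ _ d).
by field; rewrite -?natrD; do ?[apply/andP; split]; apply: lt0r_neq0; lra.
Qed.

Lemma drop_cap1 D : (2 <= D)%N -> psi_drop 1 D = (4 / 3) / (D%:R * (D%:R + 1)).
Proof.
case: D => [|[|d]] // _; rewrite /psi_drop /psi /=; have h := ler0n R d.
rewrite !(natr_succ _ d.+1) !(natr_succ _ d).
by field; rewrite -?natrD; do ?[apply/andP; split]; apply: lt0r_neq0; lra.
Qed.

Lemma drop_cap2 D : (3 <= D)%N -> psi_drop 2 D = 2 / (D%:R * (D%:R + 1)).
Proof.
case: D => [|[|[|d]]] // _; rewrite /psi_drop /psi /=; have h := ler0n R d.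
rewrite !(natr_succ _ d.+1) !(natr_succ _ d).
by field; rewrite -?natrD; do ?[apply/andP; split]; apply: lt0r_neq0; lra.
Qed.

Lemma drop_small : (psi_drop 0 1 = 5 / 6) * (psi_drop 1 1 = 1 / 3) * (psi_drop 2 1 = 2 / 9) * (psi_drop 2 2 = 1 / 9).
Proof. by rewrite /psi_drop /psi /=; do !split; lra. Qed.

(** The values are convex in the degree except at the capacity 2 and degrees up to 3,
    where all decrements are at least [1/9]. *)
Lemma drop_mono c e D s : (c <= 2)%N -> (0 < e <= D)%N -> s <= 1 / 9 -> s <= psi_drop c D -> s <= psi_drop c e.
Proof.
move=> c2 /andP[e0 eD] s9; have eD' : e%:R <= D%:R :> R by rewrite ler_nat.
case: c c2 => [|[|[|//]]] _.
- have [e1|e1] := ltnP 1 e; last first.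
    have -> : e = 1%N by apply/eqP; rewrite eqn_leq e1 e0.
    by rewrite drop_small; lra.
  have e1' : 2 <= e%:R :> R by rewrite ler_nat.
  rewrite !drop_cap0 //; last exact: leq_trans eD.
  move=> h; apply: le_trans h _; apply: ler_frac; nra.
- have [e1|e1] := ltnP 1 e; last first.
    have -> : e = 1%N by apply/eqP; rewrite eqn_leq e1 e0.
    by rewrite drop_small; lra.
  have e1' : 2 <= e%:R :> R by rewrite ler_nat.
  rewrite !drop_cap1 //; last exact: leq_trans eD.
  move=> h; apply: le_trans h _; apply: ler_frac; nra.
have [e1|e1] := ltnP 2 e; last first.
  by case: e e0 e1 {eD eD'} => [|[|[|//]]] // _ _; rewrite drop_small; lra.
have e1' : 3 <= e%:R :> R by rewrite ler_nat.
rewrite !drop_cap2 //; last exact: leq_trans eD.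
move=> h; apply: le_trans h _; apply: ler_frac; nra.
Qed.

Lemma psi_steps c e D s : (c <= 2)%N -> (e <= D)%N -> s <= 1 / 9 ->
  ((0 < D)%N -> s <= psi_drop c D) -> s * (D - e)%:R <= psi0 c e - psi0 c D.
Proof.
move=> c2 eD s9; elim: D eD => [|D IHD] eD hs.
  by move: eD; rewrite leqn0 => /eqP->; rewrite subnn mulr0 subrr lexx.
move: eD; rewrite leq_eqVlt => /orP[/eqP->|]; first by rewrite subnn mulr0 subrr lexx.
rewrite ltnS => eD; rewrite subSn // mulrS mulrDr mulr1.
have h1 := hs isT.
have : s * (D - e)%:R <= psi0 c e - psi0 c D.
  by apply: IHD => // D0; apply: (drop_mono c D D.+1); rewrite ?D0 ?leqnSn.
move: h1; rewrite {1}/psi_drop /=; lra.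
Qed.

Lemma psi_cap0 D : (0 < D)%N -> psi0 0 D = (2 / 3) / (D%:R + 3).
Proof. by case: D => // D _; rewrite /psi /= (natr_succ _ D.+1). Qed.

Lemma psi_cap1 D : (0 < D)%N -> psi0 1 D = (4 / 3) / (D%:R + 1).
Proof. by case: D => // D _; rewrite /psi /= (natr_succ _ D.+1). Qed.

Lemma psi_cap2 D : (1 < D)%N -> psi0 2 D = 2 / (D%:R + 1).
Proof. by case: D => [|[|D]] // _; rewrite /psi /= (natr_succ _ D.+2). Qed.

Lemma psi_cap1_drop D : (1 < D)%N -> psi0 1 D = D%:R * psi_drop 1 D.
Proof.
move=> D1; have h : 2 <= D%:R :> R by rewrite ler_nat.
rewrite (psi_cap1 D (ltnW D1)) drop_cap1 //; field.
by apply/andP; split; apply: lt0r_neq0; lra.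
Qed.

Lemma psi_cap2_drop D : (2 < D)%N -> psi0 2 D = D%:R * psi_drop 2 D.
Proof.
move=> D1; have h : 3 <= D%:R :> R by rewrite ler_nat.
rewrite (psi_cap2 D (ltnW D1)) drop_cap2 //; field.
by apply/andP; split; apply: lt0r_neq0; lra.
Qed.

Lemma degree_of_drop c D : (c <= 2)%N -> 1 / 9 <= psi_drop c D -> (D <= if c == 0%N then 1 else 3)%N.
Proof.
move=> c2 h; rewrite leqNgt; apply/negP => D1; move: h.
case: c c2 D1 => [|[|[|//]]] _ /= D1.
- have X2 : 2 <= D%:R :> R by rewrite ler_nat.
  rewrite drop_cap0 //; move: (D%:R) X2 => X X2; rewrite ler_pdivlMr; nra.
- have X2 : 4 <= D%:R :> R by rewrite ler_nat.
  rewrite drop_cap1; last exact: leq_trans D1.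
  move: (D%:R) X2 => X X2; rewrite ler_pdivlMr; nra.
have X2 : 4 <= D%:R :> R by rewrite ler_nat.
rewrite drop_cap2; last exact: leq_trans D1.
move: (D%:R) X2 => X X2; rewrite ler_pdivlMr; nra.
Qed.

(** Let [d] and [a] be the degree and the value of a vertex [u] of capacity 0, and [D],
    [phi] and [h] the degree, the value and the drop of a neighbour.  Summed over the [d]
    neighbours, the inequality says
    [a + sum phi <= 1 + s * sum (D - d) + d * (sum h - a)].  When deleting [u] does not
    pay, that is [sum h < a], the last term is negative, and what remains is that
    selecting [u] pays: at least [D - d] edges leave each neighbour for the rest of the
    graph, each worth [s].  The factor [d] in front of [h - a/d] is one of many that work;
    with it the value and the drop combine to [2 * (d - D)/(D * (D + 1))] for capacity 2. *)
Lemma select_ineq (c d D : nat) (a := psi0 0 d) (s := psi_drop 0 d) :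
  (2 <= d)%N -> (c <= 2)%N -> (0 < D)%N -> psi_drop c D < 1 / 9 ->
  psi0 c D - s * (D%:R - d%:R) <= (1 - a) / d%:R + d%:R * psi_drop c D - a.
Proof.
rewrite {}/a {}/s => d2; have Y2 : 2 <= d%:R :> R by rewrite ler_nat.
rewrite (psi_cap0 d (ltnW d2)).
rewrite drop_cap0 //; move: (d%:R) Y2 => Y Y2.
have Y0 : Y != 0 by apply: lt0r_neq0; lra.
have Y20 : Y + 2 != 0 by apply: lt0r_neq0; lra.
have Y30 : Y + 3 != 0 by apply: lt0r_neq0; lra.
have KE : (1 - 2 / 3 / (Y + 3)) / Y - 2 / 3 / (Y + 3) = (Y + 7) / (3 * Y * (Y + 3)).
  by field; rewrite Y0 Y30.
set s := 2 / 3 / ((Y + 2) * (Y + 3)); set K := (Y + 7) / (3 * Y * (Y + 3)) in KE.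
have K0 : 0 < K by rewrite divr_gt0 //; nra.
have s0 : 0 < s by rewrite divr_gt0 //; nra.
(* For [X > Y] the numerator over the common denominator is, with [t = X - Y], the sum of
   squares and nonnegative terms displayed below. *)
have key X : 1 <= X -> (X - Y) * (2 / (X * (X + 1)) - s) <= K.
  move=> X1; have [XY|YX] := lerP X Y.
    have : 0 <= 2 / (X * (X + 1)) - s.
      rewrite subr_ge0; apply: le_trans (_ : 2 / ((Y + 2) * (Y + 3)) <= _).
        by rewrite ler_wpM2r ?invr_ge0; nra.
      by apply: ler_frac; nra.
    by move: (2 / _ - s) => q; nra.
  pose t := X - Y; have t0 : 0 < t by rewrite subr_gt0.
  have XE : X = Y + t by rewrite /t; ring.
  rewrite XE addrAC subrr add0r -subr_ge0.
  have -> : K - t * (2 / ((Y + t) * (Y + t + 1)) - s) =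
     ((Y * (Y - t)) ^+ 2 + 4 * (Y * t) ^+ 2 + 2 * Y * t ^+ 3
       + Y * (10 * Y ^+ 2 - 9 * Y * t + 11 * t ^+ 2)
       + 23 * Y ^+ 2 + Y * t + 14 * Y + 14 * t ^+ 2 + 14 * t)
     / (3 * Y * (Y + 2) * (Y + 3) * (Y + t) * (Y + t + 1)).
    rewrite /K /s; field; rewrite Y0 Y20 Y30 /=.
    by rewrite ?andbT; do ?[apply/andP; split] => //; apply: lt0r_neq0; lra.
  have q0 : 0 <= 10 * Y ^+ 2 - 9 * Y * t + 11 * t ^+ 2.
    have := sqr_ge0 (Y - t); have := sqr_ge0 Y; have := sqr_ge0 t; nra.
  have Yp : 0 <= Y by lra.
  have tp : 0 <= t by lra.
  by nneg.
case: c => [|[|[|//]]] _ D0 hD.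
- have D2 : (2 <= D)%N.
    by move: hD; case: D D0 => [|[|D]] // _; rewrite drop_small; lra.
  have X2 : 2 <= D%:R :> R by rewrite ler_nat.
  rewrite (psi_cap0 D) // drop_cap0 //; move: (D%:R) X2 {hD} => X X2.
  have X20 : X + 2 != 0 by apply: lt0r_neq0; lra.
  have X30 : X + 3 != 0 by apply: lt0r_neq0; lra.
  set h := 2 / 3 / ((X + 2) * (X + 3)).
  have -> : 2 / 3 / (X + 3) = h * (X + 2) by rewrite /h; field; rewrite X20 X30.
  have h0 : 0 < h by rewrite divr_gt0 //; nra.
  have : 0 <= K + (X - Y) * (s - h) - 2 * h.
    have [XY|YX] := lerP X Y; last first.
      have hs : h <= s by apply: ler_frac; nra.
      have : 2 * s <= K.
        rewrite /s /K -subr_ge0.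
        have -> : (Y + 7) / (3 * Y * (Y + 3)) - 2 * (2 / 3 / ((Y + 2) * (Y + 3))) =
           (Y ^+ 2 + 5 * Y + 14) / (3 * Y * (Y + 2) * (Y + 3)).
          by field; rewrite Y0 Y20 Y30.
        by rewrite divr_ge0 //; nra.
      nra.
    pose t := Y - X; have t0 : 0 <= t by rewrite subr_ge0.
    have YE : Y = X + t by rewrite /t; ring.
    pose i := X - 2; have i0 : 0 <= i by rewrite subr_ge0.
    have XE : X = 2 + i by rewrite /i; ring.
    have -> : K + (X - Y) * (s - h) - 2 * h =
      ((Y + 7) * (Y + 2) * (X + 2) * (X + 3) + 2 * t ^+ 2 * Y * (X + Y + 5)
         - 4 * Y * (Y + 2) * (Y + 3)) / (3 * Y * (Y + 2) * (Y + 3) * (X + 2) * (X + 3)).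
      by rewrite /K /s /h /t; field; rewrite Y0 Y20 Y30 X20 X30.
    have Yp : 0 <= Y by lra.
    have Xp : 0 <= X by lra.
    apply: divr_ge0; last by nneg.
    have -> : (Y + 7) * (Y + 2) * (X + 2) * (X + 3) + 2 * t ^+ 2 * Y * (X + Y + 5)
         - 4 * Y * (Y + 2) * (Y + 3) =
      i^+4 + 18*i^+3 + 129*i^+2 + 432*i + 2*i^+3*t + 19*i^+2*t + 69*i*t + 560 + 108*t
      + 5*i^+2*t^+2 + 23*i*t^+2 + 12*t^+2 + 6*i*t^+3 + 18*t^+3 + 2*t^+4.
      by rewrite YE XE; ring.
    by nneg.
  rewrite /K; move: KE; rewrite /K => KE; rewrite -KE; lra.
- have D2 : (2 <= D)%N.
    by move: hD; case: D D0 => [|[|D]] // _; rewrite drop_small; lra.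
  have X2 : 2 <= D%:R :> R by rewrite ler_nat.
  rewrite psi_cap1 // drop_cap1 //; move: (D%:R) X2 {hD} => X X2.
  have X0 : X != 0 by apply: lt0r_neq0; lra.
  have X10 : X + 1 != 0 by apply: lt0r_neq0; lra.
  have k := key X ltac:(lra).
  set q := 1 / (X * (X + 1)).
  have -> : 4 / 3 / (X + 1) = 4 / 3 * q * X by rewrite /q; field; rewrite X0 X10.
  have -> : 4 / 3 / (X * (X + 1)) = 4 / 3 * q by rewrite /q; ring.
  have {}k : (X - Y) * (2 * q - s) <= K by move: k; rewrite /q mulrA mulr1.
  have q0 : 0 < q by rewrite divr_gt0 //; nra.
  have : (X - Y) * (4 / 3 * q - s) <= K.
    have [XY|YX] := lerP X Y; last by nra.
    have : s <= 4 / 3 * q.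
      rewrite /s /q mulrA mulr1; apply: le_trans (_ : 4 / 3 / ((Y + 2) * (Y + 3)) <= _).
        by rewrite ler_wpM2r ?invr_ge0; nra.
      by apply: ler_frac; nra.
    nra.
  rewrite -KE; lra.
have D3 : (3 <= D)%N.
  by move: hD; case: D D0 => [|[|[|D]]] // _; rewrite drop_small; lra.
have X2 : 3 <= D%:R :> R by rewrite ler_nat.
rewrite (psi_cap2 D (ltnW D3)) drop_cap2 //; move: (D%:R) X2 {hD} => X X2.
have X0 : X != 0 by apply: lt0r_neq0; lra.
have X10 : X + 1 != 0 by apply: lt0r_neq0; lra.
have k := key X ltac:(lra).
set q := 1 / (X * (X + 1)).
have -> : 2 / (X + 1) = 2 * q * X by rewrite /q; field; rewrite X0 X10.
have -> : 2 / (X * (X + 1)) = 2 * q by rewrite /q; ring.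
have {}k : (X - Y) * (2 * q - s) <= K by move: k; rewrite /q mulrA mulr1.
rewrite -KE in k; lra.
Qed.

End Drops.

(** * Sets that respect the capacities and reach the total value *)

Lemma le79_1 (R : realFieldType) : 7 / 9 <= 1 :> R. Proof. by lra. Qed.
Lemma le79_56 (R : realFieldType) : 7 / 9 <= 5 / 6 :> R. Proof. by lra. Qed.

Section Capped.
Variable G : sgraph.
Variable cap : G -> nat.
Variable R : realFieldType.
Hypothesis cap_le2 : forall x, (cap x <= 2)%N.
Implicit Types (U S T W : {set G}) (x y z u v w : G) (s t : seq G).

Local Notation nbrs := (nbrs G).
Local Notation degin := (degin G).
Local Notation charge := (charge G cap R (7 / 9)).
Local Notation gain := (gain G cap R (7 / 9)).
Local Notation attains := (attains G cap R).
Local Notation psi0 := (psi R (7 / 9)).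
Local Notation psi_drop := (psi_drop R).

Local Notation b1 := (lexx (7 / 9 : R)).
Local Notation b2 := (le79_1 R).
Local Notation b3 := (le79_56 R).

Lemma chargeE U x : charge U x = psi0 (cap x) (degin U x).
Proof. by rewrite /charge if_same. Qed.

Lemma gain_del U u y : u \in U -> y \in nbrs U u ->
  gain U (U :\ u) y = psi_drop (cap y) (degin U y).
Proof.
move=> uU; rewrite in_nbrs => /andP[yU uy].
by rewrite /gain !chargeE /psi_drop (degin_del G U u y).
Qed.

Lemma gain_steps U T x (s : R) : T \subset U -> s <= 1 / 9 ->
  ((0 < degin U x)%N -> s <= psi_drop (cap x) (degin U x)) ->
  s * (degin U x - degin T x)%:R <= gain U T x.
Proof.
by move=> TU s9 hs; rewrite /gain !chargeE; apply: psi_steps => //; apply: degin_sub.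
Qed.

(** This is where [psi] being the degree times its drop is used. *)
Lemma reduce_exact U u (s : R) : u \in U -> attains (7 / 9) (U :\ u) ->
  psi0 (cap u) (degin U u) <= (degin U u)%:R * s ->
  (forall y, y \in nbrs U u -> s <= psi_drop (cap y) (degin U y)) -> attains (7 / 9) U.
Proof.
move=> uU sol hu hs; apply: (reduce1 G cap R (7 / 9) b1 b2 U u) => //.
rewrite chargeE; apply: le_trans hu _; apply: sum_ge_card => y yN.
by rewrite gain_del // hs.
Qed.

(** If deleting [u] does not pay, no neighbour has a drop of [1/9] or more, since the
    other neighbours contribute at least [s] each, [a = (d + 2) * s]
    and [3 * s <= 1/9].  So all neighbours are in the range of [select_ineq]. *)
Lemma reduce_cap0 U u (d := degin U u) (s := psi_drop 0 d) :
  (forall T, T \proper U -> attains (7 / 9) T) ->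
  u \in U -> cap u = 0%N -> (2 <= d)%N ->
  (forall y, y \in U -> (0 < degin U y)%N -> s <= psi_drop (cap y) (degin U y)) ->
  attains (7 / 9) U.
Proof.
move=> IH uU cu d2 hs.
have inN x y : (y \in nbrs U x) -> [/\ y \in U & adj x y].
  by rewrite in_nbrs => /andP[].
have Y2 : 2 <= d%:R :> R by rewrite ler_nat.
have aE := psi_cap0 R d (ltnW d2).
have sE : s = (2 / 3) / ((d%:R + 2) * (d%:R + 3)) by rewrite /s drop_cap0.
have s0 : 0 < s by rewrite sE divr_gt0 //; move: Y2; clear - R; nra.
have sa : psi0 0 d = (d%:R + 2) * s.
  by rewrite aE sE; field; rewrite -?natrD; apply/andP; split; apply: lt0r_neq0; move: Y2; clear - R; lra.
have s27 : s <= 1 / 27.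
  rewrite sE ler_pdivrMr; move: Y2; clear - R; nra.
have s9 : s <= 1 / 9 by move: s27; clear - R; lra.
have dN y : y \in nbrs U u -> (0 < degin U y)%N.
  by move=> yN; apply: (degin_gt0 G U y u); apply: nbr_sym yN.
set a := psi0 0 d in sa aE *.
have [del|sel] := lerP a (\sum_(y in nbrs U u) psi_drop (cap y) (degin U y)).
  apply: (reduce1 G cap R (7 / 9) b1 b2 U u) => //; first by apply: IH; apply: properD1.
  rewrite chargeE cu -/d -/a; apply: le_trans del _; apply: ler_sum => y yN.
  by rewrite gain_del.
have small y : y \in nbrs U u -> psi_drop (cap y) (degin U y) < 1 / 9.
  move=> yN; rewrite ltNge; apply/negP => big.
  have : (#|nbrs U u :\ y|)%:R * s <= \sum_(z in nbrs U u :\ y) psi_drop (cap z) (degin U z).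
    apply: sum_ge_card => z; rewrite in_setD1 => /andP[_ zN].
    by apply: hs; [case: (inN _ _ zN)|exact: dN].
  have dE : d = #|nbrs U u :\ y|.+1 by rewrite /d /degin (cardsD1 y) yN.
  move: sel; rewrite (big_setD1 y) //= sa dE -natr1.
  move: (#|_|%:R) (\sum_(_ in _) _) (psi_drop _ _) big s27 => n S q; clear - R; lra.
(* Of the [D] neighbours of [y] at most [d] are lost with [u] and the other neighbours of
   [u], so at least [D - d] edges lead to remaining vertices. *)
pose g : R := \sum_(y in nbrs U u) s * ((degin U y)%:R - d%:R).
have Es : size [:: u] = 1%N by [].
apply: (reduce G cap R (7 / 9) b1 U [:: u] (enum (nbrs U u)) g) => //.
- by move=> x; rewrite inE => /eqP->.
- by apply: good_seq; rewrite //= adjxx.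
- move=> x y; rewrite inE => /eqP-> yU uy.
  by rewrite inE mem_enum in_nbrs yU uy orbT.
- by apply: IH; apply: (setD_proper G _ u); rewrite ?inE ?eqxx.
- set T := U :\: _; have TU : T \subset U := subsetDl _ _.
  have UT : U :\: T = u |: nbrs U u.
    apply/setP=> x; rewrite !inE mem_enum inE.
    by have [->|xu] := eqVneq x u; rewrite /= ?uU //; case: (x \in U); case: (adj u x).
  apply: le_trans (_ : s * (\sum_(x in T) (degin U x - degin T x))%:R <= _); last first.
    rewrite natr_sum mulr_sumr; apply: ler_sum => x xT; apply: gain_steps => // d0.
    by apply: hs => //; exact: (subsetP TU).
  rewrite (edge_count G U T TU) UT big_setU1 /=; last by rewrite in_nbrs adjxx andbF.
  rewrite natrD mulrDr natr_sum mulr_sumr.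
  apply: le_trans (_ : \sum_(y in nbrs U u) s * (degin T y)%:R <= _); last first.
    by rewrite lerDr mulr_ge0 // ltW.
  apply: ler_sum => y yN; rewrite ler_wpM2l ?(ltW s0) // lerBlDr -natrD ler_nat.
  rewrite (degin_split G U T y TU) leq_add2l UT.
  have -> : d = #|u |: (nbrs U u :\ y)|.
    by rewrite cardsU1 /d /degin (cardsD1 y (nbrs U u)) yN in_setD1 in_nbrs adjxx !andbF.
  apply/subset_leq_card/subsetP => z; rewrite in_nbrs !in_setU1 in_setD1 => /andP[/orP[->//|->] yz].
  by rewrite andbT; apply/orP; right; apply: contraTneq yz => ->; rewrite adjxx.
rewrite big_cat big_seq1 chargeE cu -/d -/a /= big_enum /=.
have key : \sum_(y in nbrs U u) (charge U y - s * ((degin U y)%:R - d%:R)) <=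
  \sum_(y in nbrs U u) ((1 - a) / d%:R + d%:R * psi_drop (cap y) (degin U y) - a).
  apply: ler_sum => y yN; rewrite chargeE; apply: select_ineq => //; [exact: dN|exact: small].
move: key; rewrite sumrB -/g => key.
have E : \sum_(y in nbrs U u) ((1 - a) / d%:R + d%:R * psi_drop (cap y) (degin U y) - a) =
  (1 - a) + d%:R * (\sum_(y in nbrs U u) psi_drop (cap y) (degin U y)) - d%:R * a.
  have sc (c : R) : \sum_(y in nbrs U u) c = d%:R * c by rewrite sumr_const mulr_natl.
  rewrite sumrB big_split /= (sc a) (sc ((1 - a) / d%:R)) -mulr_sumr.
  rewrite [d%:R * (_ / _)]mulrC divfK //; apply: lt0r_neq0; move: Y2; clear - R; lra.
rewrite E in key; move: key sel Y2.
move: (\sum_(_ in _) _) (\sum_(_ in _) _) g => p q g'; clear - R; nra.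
Qed.

(** The vertex with the smallest drop is processed, until that drop reaches [1/9].  Then
    two kinds of vertices remain that do not fit [low_degree 3]: those of capacity 1 and
    degree 3, whose value is [3 * (1/9)], and those of capacity 0 and degree 1, which can
    be selected in place of their neighbour because [1/6 + 7/9 <= 1]. *)
Theorem capped_linear_forest U : attains (7 / 9) U.
Proof.
elim/proper_ind: U => U IH.
have inN x y : (y \in nbrs U x) -> [/\ y \in U & adj x y].
  by rewrite in_nbrs => /andP[].
have dN u y : u \in U -> y \in nbrs U u -> (0 < degin U y)%N.
  by move=> uU yN; apply: (degin_gt0 G U y u); apply: nbr_sym yN.
have pD x : x \in U -> U :\ x \proper U by move=> xU; apply: properD1.
pose P x := (x \in U) && (0 < degin U x)%N.
have [/existsP[x0 Px0]|none] := boolP [exists x, P x]; last first.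
  have bU : low_degree G cap 3 U.
    move=> x xU; have : ~~ P x by apply: contra none => Px; apply/existsP; exists x.
    by rewrite /P xU /= -leqNgt leqn0 => /eqP->.
  have [S SU [gS wS]] := attains_max_degree3 G cap R cap_le2 U bU.
  exists S => //; split=> //; apply: le_trans wS; apply: ler_sum => x _; exact: (charge_leb G cap R _ _ _ _ b3).
have [u Pu hmin] : exists2 u, P u & forall y, P y -> psi_drop (cap u) (degin U u) <= psi_drop (cap y) (degin U y).
  case: (@Order.TotalTheory.arg_minP _ R G x0 P (fun x => psi_drop (cap x) (degin U x)) Px0) => u Pu h.
  by exists u.
have /andP[uU du0] := Pu.
pose s := psi_drop (cap u) (degin U u).
have hs y : y \in U -> (0 < degin U y)%N -> s <= psi_drop (cap y) (degin U y).
  by move=> yU dy; apply: hmin; rewrite /P yU dy.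
have [s9|s9] := lerP (1 / 9) s; last first.
  have cu2 := cap_le2 u.
  have exact_case : psi0 (cap u) (degin U u) <= (degin U u)%:R * s -> attains (7 / 9) U.
    move=> h; apply: (reduce_exact U u s) => //; first by apply: IH; apply: pD.
    by move=> y yN; apply: hs; [case: (inN _ _ yN)|exact: dN yN].
  have [c0|c0] := eqVneq (cap u) 0%N.
    apply: (reduce_cap0 U u) => //.
      move: s9; rewrite /s c0; case: (degin U u) du0 => [|[|d]] // _.
      by rewrite drop_small; lra.
    by rewrite /s c0 in hs.
  have [c1|c1] := eqVneq (cap u) 1%N.
    apply: exact_case; move: s9; rewrite /s c1.
    have [d1|d1] := leqP (degin U u) 1; last by rewrite psi_cap1_drop.
    have -> : degin U u = 1%N by apply/eqP; rewrite eqn_leq d1 du0.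
    by rewrite drop_small; lra.
  have c2 : cap u = 2%N by case: (cap u) cu2 c0 c1 => [|[|[|]]].
  apply: exact_case; move: s9; rewrite /s c2.
  have [d1|d1] := leqP (degin U u) 2; last by rewrite psi_cap2_drop.
  case: (degin U u) du0 d1 => [|[|[|]]] // _ _; rewrite drop_small; lra.
have h9 y : y \in U -> (0 < degin U y)%N -> 1 / 9 <= psi_drop (cap y) (degin U y).
  by move=> yU dy; apply: le_trans s9 _; apply: hs.
have [[v [vU cv dv]]|no13] := pselect (exists v, [/\ v \in U, cap v = 1%N & degin U v = 3%N]).
  apply: (reduce_exact U v (1 / 9)) => //; first by apply: IH; apply: pD.
    by rewrite cv dv /psi /=; lra.
  by move=> y yN; apply: h9; [case: (inN _ _ yN)|exact: dN yN].
have [[v [vU cv dv]]|no01] := pselect (exists v, [/\ v \in U, cap v = 0%N & degin U v = 1%N]).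
  have /card_gt0P[y yN] : (0 < #|nbrs U v|)%N by rewrite -[#|_|]/(degin U v) dv.
  have Nv := degin1P G _ _ _ dv yN; have [yU vy] := inN _ _ yN.
  apply: (reduce G cap R (7 / 9) b1 U [:: v] [:: y] 0) => //.
  - by move=> x; rewrite inE => /eqP->.
  - by apply: good_seq; rewrite //= adjxx.
  - move=> x z; rewrite inE => /eqP-> zU vz.
    by have : z \in nbrs U v; [rewrite in_nbrs zU|rewrite Nv !inE => ->; rewrite orbT].
  - by apply: IH; apply: (setD_proper G _ v); rewrite ?inE ?eqxx.
  - by apply: sumr_ge0 => x _; apply: (gain_ge0 G cap R _ b1 b2); exact: subsetDl.
  rewrite /= !big_cons big_nil !chargeE cv dv.
  have := psi_pos R (7 / 9) (cap y) (degin U y) b1 b2 (dN _ _ vU yN).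
  move: (psi0 (cap y) _) => q; rewrite {1}/psi /=; lra.
have bU : low_degree G cap 3 U.
  move=> x xU; have [d0|d0] := posnP (degin U x); first by rewrite d0.
  have := degree_of_drop R (cap x) (degin U x) (cap_le2 x) (h9 x xU d0); have := cap_le2 x.
  case E: (cap x) => [|[|[|//]]] _ //= dx.
    by case: no01; exists x; split=> //; apply/eqP; rewrite eqn_leq dx d0.
  by rewrite -ltnS ltn_neqAle dx andbT; apply/eqP => d3; apply: no13; exists x.
have [S SU [gS wS]] := attains_max_degree3 G cap R cap_le2 U bU.
exists S => //; split=> //; apply: le_trans wS; apply: ler_sum => x _; exact: (charge_leb G cap R _ _ _ _ b3).
Qed.

End Capped.

(** * Connected acyclic sets of maximum degree 2 are paths *)

Section Consecutive.
Variable T : eqType.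
Implicit Types (p : seq T) (x y v w : T).

Lemma consecutiveC p x y : consecutive p x y = consecutive p y x.
Proof. by rewrite /consecutive orbC. Qed.

Lemma consecutive_mem p x y : consecutive p x y -> (x \in p) && (y \in p).
Proof.
by rewrite /consecutive => /orP[] /infixP[a [b ->]]; rewrite !mem_cat !inE !eqxx !orbT.
Qed.

Lemma consecutive_rev p x y : consecutive (rev p) x y = consecutive p x y.
Proof.
have h s a b : infix [:: a; b] (rev s) = infix [:: b; a] s.
  by rewrite -[[:: a; b]]/(rev [:: b; a]) infix_rev.
by rewrite /consecutive !h orbC.
Qed.

Lemma consecutive_cons p v w x y : consecutive (v :: w :: p) x y =
  [|| (x == v) && (y == w), (y == v) && (x == w) | consecutive (w :: p) x y].
Proof.
rewrite /consecutive -!orbA /= !prefix0s !andbT.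
by case: (_ && _) => //=; case: ((x == w) && _) => //=; rewrite ?orbT // orbCA.
Qed.

Lemma consecutive_nth p1 p2 x y : consecutive (p1 ++ x :: y :: p2) x y.
Proof. by rewrite /consecutive; apply/orP; left; apply/infixP; exists p1, p2. Qed.

End Consecutive.

Lemma consecutive_map (T U : eqType) (f : T -> U) (p : seq T) x y : injective f ->
  consecutive (map f p) (f x) (f y) = consecutive p x y.
Proof.
move=> fi; have h a b : infix [:: f a; f b] (map f p) = infix [:: a; b] p.
  elim: p => //= z p IHp; rewrite IHp (inj_eq fi); congr (_ && _ || _).
  by case: p {IHp} => //= t p; rewrite (inj_eq fi) !prefix0s.
by rewrite /consecutive !h.
Qed.

Section Path.
Variable G : sgraph.
Implicit Types (Q S T A : {set G}) (x y v w : G).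
Local Notation nbrs := (nbrs G).
Local Notation degin := (degin G).
Local Notation acyclic := (acyclic G).

(** Connectedness as the absence of a closed proper part, which survives the removal of
    a vertex with one neighbour more easily than the existence of connecting paths. *)
Definition conn Q := forall A, A \subset Q -> A != set0 ->
  (forall x y, x \in A -> y \in Q -> adj x y -> y \in A) -> A = Q.

(** Remove a vertex [v] with one neighbour [w].  In the path that lists the rest, [w] has
    at most one neighbour left, so it is an end, and [v] can be put next to it. *)
Lemma core_path Q : Q != set0 -> conn Q -> acyclic Q -> (forall x, x \in Q -> (degin Q x <= 2)%N) ->
  exists p : seq G, [/\ p != [::], uniq p, p =i Q &
    forall x y, x \in Q -> y \in Q -> adj x y = consecutive p x y].
Proof.
have [n] := ubnP #|Q|; elim: n Q => // n IHn Q /ltnSE cQ Q0 cnQ aQ dQ.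
have [v vQ dv] := aQ Q (subxx _) Q0.
have [Qv|Qv] := eqVneq Q [set v].
  exists [:: v]; split=> // [x|x y]; first by rewrite Qv !inE.
  rewrite Qv !inE => /eqP-> /eqP->; rewrite adj_irrefl /consecutive /=.
  by rewrite andbF.
have [w wN] : exists w, w \in nbrs Q v.
  apply/set0Pn; apply/eqP => N0; move/eqP: Qv; apply; apply/esym/cnQ.
  - by rewrite sub1set.
  - by apply/set0Pn; exists v; rewrite inE.
  move=> x y; rewrite inE => /eqP-> yQ vy.
  have: y \in nbrs Q v by rewrite in_nbrs yQ.
  by rewrite N0 in_set0.
have Nv : nbrs Q v = [set w].
  apply: (degin1P G Q v w) => //; apply/eqP; rewrite eqn_leq dv; exact: (degin_gt0 G Q v w).
have [wQ vw] : w \in Q /\ adj v w by move: wN; rewrite in_nbrs => /andP[].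
have wv : w != v by apply: contraTneq vw => ->; rewrite adj_irrefl.
pose Q' := Q :\ v; have Q'Q : Q' \subset Q := subsetDl _ _.
have wQ' : w \in Q' by rewrite !inE wv.
have adjv y : y \in Q -> adj v y -> y = w.
  by move=> yQ vy; apply/set1P; rewrite -Nv in_nbrs yQ.
have cn' : conn Q'.
  move=> A AQ' A0 cl; have AQ := subset_trans AQ' Q'Q.
  have vA : v \notin A by apply/negP => /(subsetP AQ'); rewrite !inE eqxx.
  case: (boolP (w \in A)) => wA.
    rewrite -[A](setU1K vA); congr (_ :\ _); apply: cnQ.
    - by rewrite subUset sub1set vQ.
    - by apply/set0Pn; exists v; rewrite !inE eqxx.
    move=> x y; rewrite !inE => /orP[/eqP->|xA] yQ xy; first by rewrite (adjv y yQ xy) wA orbT.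
    have [//|yv] := eqVneq y v; apply: cl xA _ xy; by rewrite !inE yv.
  suff E : A = Q by rewrite E vQ in vA.
  apply: cnQ => // x y xA yQ xy; have [yv|yv] := eqVneq y v; last by apply: cl xA _ xy; rewrite !inE yv.
  move: wA; rewrite -(adjv x) ?xA //; first exact: (subsetP AQ).
  by rewrite adj_sym -yv.
have [p [p0 up pQ pE]] : exists p : seq G, [/\ p != [::], uniq p, p =i Q' &
    forall x y, x \in Q' -> y \in Q' -> adj x y = consecutive p x y].
  apply: IHn => //.
  - by apply: leq_trans cQ; rewrite [X in (_ < X)%N](cardsD1 v) vQ.
  - by apply/set0Pn; exists w.
  - exact: acyclicS aQ.
  - by move=> x /(subsetP Q'Q)/dQ; apply: leq_trans; apply: degin_sub.
have dw : (degin Q' w <= 1)%N.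
  have := dQ w wQ; rewrite (degin_del G Q v w) //.
(* [w] is an end of [p]; up to reversal it is the first element. *)
have [q [uq qQ qE]] : exists q : seq G, [/\ uniq (w :: q), (w :: q) =i Q' &
    forall x y, x \in Q' -> y \in Q' -> adj x y = consecutive (w :: q) x y].
  have wp : w \in p by rewrite pQ.
  case/splitPr: wp p0 up pQ pE => p1 p2 p0 up pQ pE.
  case: p2 p0 up pQ pE => [|b p2] p0 up pQ pE.
    exists (rev p1); rewrite -rev_rcons -cats1; split; first by rewrite rev_uniq.
      by move=> x; rewrite mem_rev pQ.
    by move=> x y xQ yQ; rewrite consecutive_rev pE.
  case/lastP: p1 p0 up pQ pE => [|p1 a] p0 up pQ pE; first by exists (b :: p2).
  have aQ' : a \in Q' by rewrite -pQ mem_cat mem_rcons inE eqxx.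
  have bQ' : b \in Q' by rewrite -pQ mem_cat !inE eqxx !orbT.
  have wa : adj w a by rewrite pE // consecutiveC cat_rcons consecutive_nth.
  have wb : adj w b by rewrite pE // consecutive_nth.
  have ab : a != b.
    apply: contraTneq up => ->; rewrite cat_uniq negb_and; apply/orP; right.
    rewrite negb_and; apply/orP; left; rewrite negbK; apply/hasP; exists b; rewrite ?inE ?eqxx ?orbT //.
    by rewrite mem_rcons inE eqxx.
  have : (#|[set a; b]| <= degin Q' w)%N.
    by apply/subset_leq_card/subsetP => x; rewrite !inE => /orP[]/eqP->;
       rewrite ?wa ?wb andbT; [move: aQ'|move: bQ']; rewrite !inE.
  by rewrite cards2 ab => /leq_trans/(_ dw).
have vq : v \notin w :: q by rewrite qQ !inE eqxx.
exists (v :: w :: q); split=> //.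
- by rewrite /= in vq uq *; rewrite vq.
- by move=> x; rewrite in_cons qQ !inE; case: eqP => // ->.
move=> x y xQ yQ; rewrite consecutive_cons.
have nv t : consecutive (w :: q) v t = false.
  by apply/negP => /consecutive_mem/andP[]; rewrite (negPf vq).
have [->|xv] /= := eqVneq x v.
  rewrite nv [v == w]eq_sym (negPf wv) andbF !orbF.
  apply/idP/eqP => [|-> //]; exact: adjv.
have [->|yv] /= := eqVneq y v.
  rewrite consecutiveC nv orbF adj_sym.
  apply/idP/eqP => [|-> //]; exact: adjv.
by apply: qE; rewrite !inE ?xv ?yv.
Qed.

End Path.

(** * Caterpillars *)

Lemma acyclic_forest (G : sgraph) : acyclic G setT -> is_forest G.
Proof.
move=> aG c /andP[cy uc]; rewrite ltnNge; apply/negP => c3.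
have [] := aG [set x in c] (subsetT _).
  by case: c c3 {cy uc} => // x c _; apply/set0Pn; exists x; rewrite !inE eqxx.
move=> v; rewrite inE => vc; apply/negP; rewrite -ltnNge.
have [i p E] := rot_to vc.
have mem x : (x \in c) = (x \in v :: p) by rewrite -E mem_rot.
have sz : (2 <= size p)%N by rewrite -ltnS -[(size p).+1]/(size (v :: p)) -E size_rot.
move: cy uc; rewrite -(rot_cycle i) -(rot_uniq i) E.
case: p sz {E} mem => [|y [|z p]] // _ mem /= /andP[vy]; rewrite rcons_path => /and3P[_ _ lv].
case/and3P=> _ yp _; set l := last z p in lv.
have yl : y != l by apply: contraNneq yp => ->; rewrite mem_last.
have : (#|[set y; l]| <= degin G [set x in c] v)%N; last by rewrite cards2 yl.
apply/subset_leq_card/subsetP => x; rewrite !inE => /orP[]/eqP->.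
  by rewrite vy mem !inE eqxx orbT.
by rewrite adj_sym lv mem !inE -[(l == z) || _]/(l \in z :: p) mem_last !orbT.
Qed.

Section Induced.
Variables (G : sgraph) (S : {set G}).

Lemma degin_induced (T : {set induced S}) (x : induced S) :
  degin (induced S) T x = degin G [set val y | y in T] (val x).
Proof.
rewrite /degin -(card_imset _ val_inj); apply: eq_card => y; rewrite !inE.
apply/imsetP/andP => [[z]|[/imsetP[z zT ->] xz]].
  by rewrite inE => /andP[zT xz] ->; rewrite imset_f.
by exists z => //; rewrite inE zT.
Qed.

Lemma acyclic_induced : acyclic G S -> acyclic (induced S) setT.
Proof.
move=> aS T _ T0.
have [||v' /imsetP[v vT ->] dv] := aS [set val y | y in T].
- by apply/subsetP => _ /imsetP[y _ ->]; exact: valP.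
- by case/set0Pn: T0 => x xT; apply/set0Pn; exists (val x); rewrite imset_f.
by exists v => //; rewrite degin_induced.
Qed.

Lemma val_lift (p : seq G) : {subset p <= S} -> exists q : seq (induced S), map val q = p.
Proof.
elim: p => [_|x p IHp xpS]; first by exists [::].
have [|q <-] := IHp; first by move=> y yp; apply: xpS; rewrite inE yp orbT.
have xS : x \in S by apply: xpS; rewrite inE eqxx.
by exists (exist _ x xS :: q).
Qed.

End Induced.

Section Component.
Variable G : sgraph.
Implicit Types (Q : {set G}) (x y v : G).

Lemma adj_connect_sym : connect_sym (@adj G).
Proof. exact/sym_connect_sym/adj_sym. Qed.

Lemma component_closed v x y : x \in component v -> adj x y -> y \in component v.
Proof. by rewrite !inE => vx /connect1; apply: connect_trans. Qed.

Lemma component_connected v : is_connected (induced (component v)).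
Proof.
have vv : v \in component v by rewrite inE connect0.
split; first by apply/card_gt0P; exists (exist _ v vv).
move=> x y.
have : connect (@adj G) (val x) (val y).
  apply: (@connect_trans _ _ v); last by have := valP y; rewrite inE.
  by rewrite adj_connect_sym; have := valP x; rewrite inE.
case/connectP => p; elim: p x => [x _ /= E|z p IHp x /= /andP[xz zp] E].
  by have -> : x = y by exact/esym/val_inj.
have zK := component_closed v _ _ (valP x) xz.
have xz' : adj x (exist _ z zK : induced (component v)) by [].
by apply: (connect_trans (connect1 xz')); apply: IHp.
Qed.

(** The set [Q] is the vertex set of the spine.  A vertex that is adjacent to [Q] without
    belonging to it has no other neighbour, so [Q] and these vertices are closed under
    adjacency and make up the component. *)
Lemma component_caterpillar v Q :
  acyclic G setT -> Q \subset component v -> Q != set0 -> conn G Q ->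
  (forall x, x \in Q -> (degin G Q x <= 2)%N) ->
  (forall x y, x \in Q -> y \notin Q -> adj x y -> (degin G setT y <= 1)%N) ->
  is_caterpillar (induced (component v)).
Proof.
move=> aG QK Q0 cQ dQ legs; set K := component v in QK *.
have aK : acyclic G K by apply: acyclicS aG.
split; first by split; [exact/acyclic_forest/acyclic_induced|exact: component_connected].
have [p [p0 up pQ pE]] := core_path G Q Q0 cQ (acyclicS _ _ _ QK aK) dQ.
have leg1 a x y : a \in Q -> x \notin Q -> adj a x -> adj x y -> y = a.
  move=> aQ xQ ax xy; have aN : a \in nbrs G setT x by rewrite !inE adj_sym.
  have : y \in nbrs G setT x by rewrite !inE.
  rewrite (degin1P G setT x a) ?inE => [/eqP //||//]; last by rewrite adj_sym.
  by apply/eqP; rewrite eqn_leq (legs a x) // (degin_gt0 G setT x a).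
have KQ x : x \in K -> x \notin Q -> exists2 a, a \in Q & adj a x.
  pose B := Q :|: [set x | [exists a in Q, adj a x]].
  have cB : closed (@adj G) B.
    apply: (intro_closed adj_connect_sym) => a b ab; rewrite [a \in B]inE => aB.
    have [aQ|aQ] := boolP (a \in Q).
      by rewrite inE; apply/orP; right; rewrite inE; apply/existsP; exists a; rewrite aQ.
    move: aB; rewrite (negPf aQ) /= inE => /existsP[q /andP[qQ qa]].
    by rewrite (leg1 q a b) // inE qQ.
  case/set0Pn: Q0 => r rQ; have rK := subsetP QK _ rQ.
  move=> xK xQ; have : x \in B.
    rewrite -(closed_connect cB (_ : connect _ r x)) ?inE ?rQ //.
    apply: (@connect_trans _ _ v); last by move: xK; rewrite inE.
    by rewrite adj_connect_sym; move: rK; rewrite inE.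
  by rewrite inE (negPf xQ) /= inE => /existsP[a /andP[aQ ax]]; exists a.
have [q qp] : exists q : seq (induced K), map val q = p.
  by apply: val_lift => x; rewrite pQ => /(subsetP QK).
have qQ (x : induced K) : (x \in q) = (val x \in Q) by rewrite -pQ -qp mem_map //; exact: val_inj.
pose a (x : induced K) := odflt x [pick y | (y \in q) && adj x y].
have aP (x : induced K) : x \notin q -> a x \in q /\ forall y : induced K, adj x y = (y == a x).
  move=> xq; have xQ : val x \notin Q by rewrite -qQ.
  have [b bQ bx] := KQ (val x) (valP x) xQ.
  rewrite /a; case: pickP => [y /andP[yq xy]|no].
    split=> // z; apply/idP/eqP => [xz|->//]; apply: val_inj.
    have h := leg1 b (val x) _ bQ xQ bx.
    by rewrite (h (val z) xz) (h (val y) xy).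
  have bK := subsetP QK _ bQ; have := no (exist _ b bK : induced K).
  by rewrite qQ /= bQ /= adj_sym bx.
exists q, a; split.
- by apply: contraNneq p0 => E; rewrite -qp E.
- by move: up; rewrite -qp; apply: map_uniq.
- by move=> x /aP[].
move=> x y; have nc (z w : induced K) : z \notin q -> consecutive q z w = false.
  by move=> zq; apply/negP => /consecutive_mem/andP[zq' _]; rewrite zq' in zq.
have [xq|xq] := boolP (x \in q); have [yq|yq] := boolP (y \in q); rewrite /= ?orbF.
- by rewrite pE -?qQ // -qp consecutive_map //; exact: val_inj.
- by rewrite consecutiveC nc //= adj_sym; exact: (proj2 (aP y yq)).
- by rewrite nc //; exact: (proj2 (aP x xq)).
have [axq axE] := aP x xq; rewrite nc //=.
have nadj : (y == a x) = false by apply: contraNF yq => /eqP->.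
have nadj' : (x == a y) = false.
  by have [ayq _] := aP y yq; apply: contraNF xq => /eqP->.
rewrite nadj nadj' /= -[RHS]nadj; exact: axE.
Qed.

(** The spine of a component is a component of the graph induced by [C], or a single
    vertex if the component does not meet [C]; in the latter case it is a vertex or an
    edge. *)
Lemma core_caterpillars (C : {set G}) : acyclic G setT ->
  (forall x, x \in C -> (degin G C x <= 2)%N) ->
  (forall x, x \notin C -> (degin G setT x <= 1)%N) ->
  forall v, is_caterpillar (induced (component v)).
Proof.
move=> aG dC legs v.
have [/existsP[r /andP[rK rC]]|none] := boolP [exists r, (r \in component v) && (r \in C)].
  pose e := [rel x y | [&& adj x y, x \in C & y \in C]].
  have eS : connect_sym e.
    by apply: sym_connect_sym => x y; rewrite /= adj_sym [(y \in C) && _]andbC.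
  pose Q := [set x | connect e r x].
  have QC : Q \subset C.
    apply/subsetP => x; rewrite inE => /connectP[q]; elim/last_ind: q => [_ ->//|q z _].
    by rewrite rcons_path last_rcons => /andP[_ /and3P[_ _ zC]] ->.
  apply: (component_caterpillar v Q) => //.
  - apply/subsetP => x; rewrite !inE => rx; move: rK; rewrite inE => vr.
    apply: connect_trans vr _; apply: connect_sub rx => a b /and3P[ab _ _]; exact: connect1.
  - by apply/set0Pn; exists r; rewrite inE connect0.
  - move=> A AQ A0 cl; apply/eqP; rewrite eqEsubset AQ; case/set0Pn: A0 => a aA.
    have cA : closed e A.
      apply: (intro_closed eS) => x y exy xA; apply: (cl x) => //.
        move: (subsetP AQ _ xA); rewrite !inE => rx; exact: connect_trans rx (connect1 exy).
      by case/and3P: exy.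
    apply/subsetP => y yQ; rewrite -(closed_connect cA (_ : connect e a y)) //.
    move: (subsetP AQ _ aA) yQ; rewrite !inE => ra ry; apply: connect_trans ry.
    by rewrite eS.
  - by move=> x /(subsetP QC)/dC; apply: leq_trans; apply: degin_sub.
  - move=> x y xQ yQ xy; have xC := subsetP QC _ xQ; apply: legs; apply: contra yQ => yC; move: xQ; rewrite !inE => rx.
    apply: connect_trans rx (connect1 _); by rewrite /= xy xC yC.
have none' x : x \in component v -> (degin G setT x <= 1)%N.
  by move=> xK; apply: legs; apply: contra none => xC; apply/existsP; exists x; rewrite xK.
have vK : v \in component v by rewrite inE connect0.
apply: (component_caterpillar v [set v]) => //.
- by rewrite sub1set.
- by apply/set0Pn; exists v; rewrite inE.
- move=> A Av A0 _; apply/eqP; rewrite eqEsubset Av sub1set; case/set0Pn: A0 => a aA.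
  by have := subsetP Av _ aA; rewrite inE => /eqP <-.
- move=> x _; apply: leq_trans (_ : #|[set v]| <= 2)%N; [apply/subset_leq_card/subsetP => y; by rewrite !inE => /andP[]|by rewrite cards1].
- move=> x y; rewrite inE => /eqP-> _ vy; apply: none'; exact: component_closed vK vy.
Qed.

End Component.

(** * From capacities to caterpillar forests *)

Lemma deg_degin (G : sgraph) (v : G) : deg v = degin G setT v.
Proof. by apply: eq_card => w; rewrite !inE. Qed.

Lemma alpha_ge (C : sgraph -> Prop) (G : sgraph) (S : {set G}) :
  C (induced S) -> (#|S| <= alpha C G)%N.
Proof. by move=> CS; apply: (@leq_bigmax_cond _ _ (fun S : {set G} => #|S|)); apply/asboolP. Qed.

Section Attach.
Variables (G : sgraph) (k : nat).
Hypothesis k2 : (2 <= k)%N.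

Definition leaves : {set G} := [set v | deg v == 1%N].
Definition nleaf (v : G) : nat := degin G leaves v.
(** The vertices that remain to be decided.  A component that is a single edge consists
    of two leaves and is disjoint from this set. *)
Definition skeleton : {set G} := [set v | (deg v != 1%N) && (nleaf v <= k)%N].
Definition allowance (v : G) : nat := minn 2 (k - nleaf v).

Lemma attach_leaves (S : {set G}) : S \subset skeleton -> good G allowance S ->
  caterpillar_forest k (induced (S :|: leaves)).
Proof.
move=> SC [dS aS]; set W := S :|: leaves.
have leaf1 x (T : {set G}) : x \in leaves -> (degin G T x <= 1)%N.
  by rewrite inE deg_degin => /eqP <-; apply: degin_sub; apply: subsetT.
have aW : acyclic G W.
  move=> T TW T0; have [TL|/set0Pn[v]] := eqVneq (T :&: leaves) set0.
    apply: aS => //; apply/subsetP => x xT; move/(subsetP TW): (xT).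
    rewrite inE => /orP[//|xL]; have: x \in T :&: leaves by rewrite inE xT.
    by rewrite TL inE.
  by rewrite inE => /andP[vT vL]; exists v => //; exact: leaf1.
have aI := acyclic_induced _ _ aW.
have valT : [set val y | y in [set: induced W]] = W.
  apply/setP => x; apply/imsetP/idP => [[y _ ->]|xW]; first exact: valP.
  by exists (exist _ x xW).
split; first exact: acyclic_forest.
  move=> x; rewrite deg_degin degin_induced valT.
  have := valP x; rewrite inE => /orP[xS|/leaf1 h]; last by apply: leq_trans (h _) _; lia.
  have := subsetP SC _ xS; rewrite inE => /andP[_ px].
  apply: leq_trans (_ : degin G S (val x) + nleaf (val x) <= _)%N.
    rewrite /nleaf /degin -cardsUI; apply: leq_trans (leq_addr _ _).
    by apply/subset_leq_card/subsetP => y; rewrite !inE => /andP[/orP[]->->]; rewrite ?orbT.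
  have := dS _ xS; rewrite /allowance => h; apply: leq_trans (leq_add h (leqnn _)) _.
  by rewrite addnC -leq_subRL // geq_minr.
apply: (core_caterpillars (induced W) [set x : induced W | val x \in S]) => // x; rewrite inE => xS.
  rewrite degin_induced; apply: leq_trans (_ : degin G S (val x) <= _)%N.
    by apply: degin_sub; apply/subsetP => _ /imsetP[y + ->]; rewrite inE.
  by apply: leq_trans (dS _ xS) _; rewrite geq_minl.
rewrite degin_induced valT; apply: leaf1; have := valP x; rewrite inE.
by rewrite (negPf xS).
Qed.

Lemma sum_nleaf : (\sum_(v in ~: leaves) nleaf v <= #|leaves|)%N.
Proof.
rewrite -setTD -(edge_count G setT leaves (subsetT _)) -sum1_card.
by apply: leq_sum => x; rewrite inE deg_degin => /eqP->; apply: leq_subr.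
Qed.

End Attach.

Section Bound.
Variables (R : realType) (k : nat).
Hypothesis k2 : (2 <= k)%N.
Variable eps : R.
Hypothesis e0 : 0 <= eps.

Lemma fkeps_le d : (2 <= d)%N -> fkeps k eps d <= 2 / d.+1%:R.
Proof.
case: d => [|[|d]] // _; rewrite /fkeps /=; case: ifP => // _.
by rewrite ge_min lexx orbT.
Qed.

Lemma fkeps_le1 d : fkeps k eps d <= 1.
Proof.
case: d => [|[|d]]; rewrite /fkeps //=; first by move: e0; lra.
apply: le_trans (fkeps_le d.+2 isT) _.
by rewrite ler_pdivrMr // mul1r ler_nat.
Qed.

Lemma fkeps_big d : (k < d)%N -> fkeps k eps d = Num.min (k.+1%:R * eps) (2 / d.+1%:R).
Proof.
move=> kd; rewrite /fkeps; case: d kd => [|[|d]] //= kd; first by lia.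
by rewrite leqNgt kd.
Qed.

(** For fixed [B] the left side is largest at [A = B]. *)
Lemma min_elim (A B r : R) : 0 <= r <= 1 -> Num.min A B - (1 - r) * A <= r * B.
Proof. by move=> /andP[r0 r1]; rewrite minEle; case: ifP => [h|/negbT]; rewrite -?ltNge => *; nra. Qed.

(** For [l >= k - 1] and [d > k] the value exceeds the debt of the leaves only by
    [2/(k+1)] or [1/(k+1)] of [2/(d+1)] ([min_elim] with [A = (k+1) * eps]).  These
    bounds are weakest for [k = 2], which is where the constants [4/3] and [2/3] of [psi]
    come from. *)
Lemma fkeps_psi d l : (l <= k)%N -> (l <= d)%N -> d != 1%N ->
  fkeps k eps d - eps * l%:R <= psi R (7 / 9) (minn 2 (k - l)) (d - l).
Proof.
move=> lk ld d1; have el : 0 <= eps * l%:R by rewrite mulr_ge0.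
have [->|e1] := posnP (d - l).
  by rewrite {1}/psi /=; have := fkeps_le1 d; move: el; lra.
have d2 : (2 <= d)%N by lia.
have fd := fkeps_le d d2.
have K3 : 3 <= k.+1%:R :> R by rewrite ler_nat.
have dE : d%:R = (d - l)%:R + l%:R :> R by rewrite -natrD subnK.
have E1 : 1 <= (d - l)%:R :> R by rewrite ler1n.
have L0 := ler0n R l.
have dS : d.+1%:R = d%:R + 1 :> R by rewrite -natr1.
have [l2|l2] := leqP l.+2 k.
  have -> : minn 2 (k - l) = 2%N by apply/minn_idPl; lia.
  apply: le_trans (_ : 2 / d.+1%:R <= _); first by rewrite lerBlDr (le_trans fd) // lerDl.
  have [e2|e2] := ltnP 1 (d - l).
    by rewrite psi_cap2 //; apply: ler_frac => //; rewrite ?dS ?dE; move: L0 E1; lra.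
  have -> : (d - l)%N = 1%N by lia.
  apply: le_trans (_ : 2 / 3 <= _); last by rewrite /psi /=; lra.
  by apply: ler_frac; rewrite ?ler_nat.
have [l1|l1] := ltnP l k.
  have -> : minn 2 (k - l) = 1%N by lia.
  have [e2|e2] := ltnP 1 (d - l); last first.
    have -> : (d - l)%N = 1%N by lia.
    apply: le_trans (_ : 2 / 3 <= _); last by rewrite /psi /=; lra.
    apply: le_trans (_ : 2 / d.+1%:R <= _); first by rewrite lerBlDr (le_trans fd) // lerDl.
    by apply: ler_frac; rewrite ?ler_nat.
  rewrite fkeps_big; last by lia.
  have lE : l%:R = k.+1%:R - 2 :> R.
    by rewrite -[2]/(2%:R) -natrB ?ltnS 1?ltnW //; congr (_%:R); lia.
  have -> : eps * l%:R = (1 - 2 / k.+1%:R) * (k.+1%:R * eps).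
    by rewrite lE; field; apply: lt0r_neq0; move: K3; lra.
  apply: le_trans (min_elim _ _ _ _) _.
    by rewrite divr_ge0 //= ler_pdivrMr //; move: K3; lra.
  rewrite psi_cap1 //; apply: le_trans (_ : 2 / 3 * (2 / d.+1%:R) <= _).
    by rewrite ler_wpM2r ?divr_ge0 //; apply: ler_frac.
  have -> : 2 / 3 * (2 / d.+1%:R) = 4 / 3 / d.+1%:R :> R by rewrite mulrA; congr (_ / _); lra.
  apply: ler_frac; [by rewrite divr_ge0|by move: E1; lra|].
  by rewrite dS dE; move: L0; lra.
have lk' : l = k by apply/eqP; rewrite eqn_leq lk.
have -> : minn 2 (k - l) = 0%N by rewrite lk' subnn minn0.
rewrite fkeps_big; last by lia.
have lE : l%:R = k.+1%:R - 1 :> R by rewrite lk' -natr1; lra.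
have -> : eps * l%:R = (1 - 1 / k.+1%:R) * (k.+1%:R * eps).
  by rewrite lE; field; apply: lt0r_neq0; move: K3; lra.
apply: le_trans (min_elim _ _ _ _) _.
  by rewrite divr_ge0 //= ler_pdivrMr //; move: K3; lra.
rewrite psi_cap0 //; apply: le_trans (_ : 1 / 3 * (2 / d.+1%:R) <= _).
  by rewrite ler_wpM2r ?divr_ge0 //; apply: ler_frac.
have -> : 1 / 3 * (2 / d.+1%:R) = 2 / 3 / d.+1%:R :> R by rewrite mulrA; congr (_ / _); lra.
apply: ler_frac; [by rewrite divr_ge0|by move: E1; lra|].
by rewrite dS dE; move: K3 L0; rewrite lE; lra.
Qed.

(** Each leaf outside the components with one edge has one neighbour of higher degree, so
    the sum of [eps] over the leaves is at least the sum of [eps * nleaf v] over the other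
    vertices. *)
Lemma fkeps_sum (G : sgraph) :
  \sum_(v : G) fkeps k eps (deg v) <= (alpha (caterpillar_forest k) G)%:R.
Proof.
have r2 x : (allowance G k x <= 2)%N by exact: geq_minl.
have [S SC [gS wS]] := capped_linear_forest G (allowance G k) R r2 (skeleton G k).
have := alpha_ge _ _ _ (attach_leaves G k k2 S SC gS).
have -> : #|S :|: leaves G| = (#|S| + #|leaves G|)%N.
  rewrite cardsU (_ : S :&: leaves G = set0) ?cards0 ?subn0 //.
  apply/setP => x; rewrite in_set0 in_setI; apply/negP => /andP[/(subsetP SC)].
  by rewrite !inE => /andP[/negPf->].
rewrite -(ler_nat R) natrD; apply: le_trans.
rewrite (bigID (mem (leaves G))) /= addrC.
have -> : \sum_(v in leaves G) fkeps k eps (deg v) = #|leaves G|%:R * (1 - eps).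
  rewrite mulr_natl -sumr_const; apply: eq_bigr => x.
  by rewrite inE => /eqP->.
have h1 : \sum_(v | v \notin leaves G) eps * (nleaf G v)%:R <= eps * #|leaves G|%:R.
  rewrite -mulr_sumr ler_wpM2l // -natr_sum ler_nat.
  by have := sum_nleaf G; under eq_bigl do rewrite inE.
have h2 : \sum_(v | v \notin leaves G) (fkeps k eps (deg v) - eps * (nleaf G v)%:R) <= #|S|%:R.
  apply: le_trans wS; rewrite /total_charge.
  rewrite (bigID (fun v => nleaf G v <= k)%N) /= -[X in _ <= X]addr0; apply: lerD.
    rewrite (eq_bigl (mem (skeleton G k))); last by move=> v; rewrite !inE.
    apply: ler_sum => v vC; have : v \in skeleton G k by []. 
    rewrite in_set => /andP[d1 pk]; rewrite chargeE.
    have dsum : (degin G (skeleton G k) v <= deg v - nleaf G v)%N.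
      rewrite leq_subRL; last by rewrite deg_degin; apply: degin_sub; apply: subsetT.
      rewrite deg_degin (degin_split G setT (leaves G)) ?subsetT // leq_add2l; apply: degin_sub.
      by apply/subsetP => x; rewrite !inE => /andP[-> _].
    apply: le_trans (psi_leq R (7 / 9) _ _ _ (lexx _) (le79_1 R) dsum).
    by apply: fkeps_psi => //; rewrite deg_degin; apply: degin_sub; apply: subsetT.
  apply: sumr_le0 => v /andP[vL pk']; have pk : (k < nleaf G v)%N by rewrite ltnNge.
  have pd : (nleaf G v <= deg v)%N by rewrite deg_degin; apply: degin_sub; apply: subsetT.
  rewrite fkeps_big ?subr_le0; last exact: leq_trans pd.
  apply: le_trans (_ : k.+1%:R * eps <= _); first by rewrite ge_min lexx.
  by rewrite mulrC ler_wpM2l // ler_nat.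
move: h2; rewrite sumrB; move: h1.
by move: (\sum_(_ | _) _) (\sum_(_ | _) _) => p q h1 h2; lra.
Qed.

End Bound.

(** * Necessary conditions *)

Lemma alpha_le (C : sgraph -> Prop) (G : sgraph) m :
  (forall S : {set G}, C (induced S) -> (#|S| <= m)%N) -> (alpha C G <= m)%N.
Proof. by move=> h; apply/bigmax_leqP => S /asboolP; apply: h. Qed.

Section Complete.
Variable n : nat.
Definition complete_adj : rel 'I_n := fun x y => x != y.
Lemma complete_sym : symmetric complete_adj.
Proof. by move=> x y; rewrite /complete_adj eq_sym. Qed.
Lemma complete_irr : irreflexive complete_adj.
Proof. by move=> x; rewrite /complete_adj eqxx. Qed.
Definition complete := SGraph complete_sym complete_irr.

Lemma deg_complete (v : complete) : deg v = n.-1.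
Proof.
rewrite /deg -[in RHS](card_ord n) -(cardsC1 v); apply: eq_card => w.
by rewrite !inE /= /complete_adj eq_sym.
Qed.

Lemma alpha_complete k : (alpha (caterpillar_forest k) complete <= 2)%N.
Proof.
apply: alpha_le => S [fS _ _]; rewrite leqNgt; apply/negP.
case/card_gt2P => x [y [z [[xS yS zS] [xy yz zx]]]].
suff: ucycle (@adj (induced S)) [:: exist _ x xS; exist _ y yS; exist _ z zS] by move/fS.
apply/andP; split.
  by apply/and4P; split; [exact: xy|exact: yz|exact: zx|].
by apply: (@map_uniq _ _ val); rewrite /= !inE negb_or xy [x == z]eq_sym zx yz.
Qed.
End Complete.

Section Brush.
Variables n k : nat.
(** [(i, None)] is the [i]-th vertex of the complete graph, and [(i, Some b)] are its
    pendant vertices. *)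
Definition brush_adj : rel ('I_n * option 'I_k.+1) := fun x y =>
  match x.2, y.2 with
  | None, None => x.1 != y.1
  | Some _, Some _ => false
  | _, _ => x.1 == y.1
  end.
Lemma brush_sym : symmetric brush_adj.
Proof. by move=> [i [a|]] [j [b|]]; rewrite /brush_adj //= eq_sym. Qed.
Lemma brush_irr : irreflexive brush_adj.
Proof. by move=> [i [a|]]; rewrite /brush_adj //= eqxx. Qed.
Definition brush := SGraph brush_sym brush_irr.

Lemma deg_hub i : deg ((i, None) : brush) = (n.-1 + k.+1)%N.
Proof.
rewrite /deg; have -> : [set w : brush | adj ((i, None) : brush) w] =
    [set (j, None) | j in [set~ i]] :|: [set (i, Some b) | b in [set: 'I_k.+1]].
  apply/setP => -[j [b|]]; rewrite !inE /= /brush_adj /=.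
    apply/idP/orP => [/eqP /= <-|[/imsetP[? _ []]//|/imsetP[b' _ [-> _]] /=]].
      by right; rewrite imset_f ?inE.
    by rewrite eqxx.
  apply/idP/orP => [ij|[/imsetP[j' + [->]]|/imsetP[? _ []]//]].
    by left; rewrite imset_f // !inE eq_sym.
  by rewrite !inE eq_sym.
rewrite cardsU (_ : _ :&: _ = set0) ?cards0 ?subn0; last first.
  apply/setP => -[j b]; rewrite !inE; apply/negP => /andP[/imsetP[? _ [_ ->]] /imsetP[? _ []//]].
rewrite !card_imset ?cardsC1 ?cardsT ?card_ord //; first by move=> ? ? [].
by move=> ? ? [].
Qed.

Lemma deg_bristle i b : deg ((i, Some b) : brush) = 1%N.
Proof.
rewrite /deg -(cards1 ((i, None) : brush)); apply: eq_card => -[j [c|]]; rewrite !inE /= /brush_adj /=.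
  by apply/esym/eqP.
by rewrite xpair_eqE eqxx andbT eq_sym.
Qed.

Lemma sum_brush (R : nmodType) (F : brush -> R) :
  \sum_(v : brush) F v = \sum_(i < n) (F (i, None) + \sum_(b < k.+1) F (i, Some b)).
Proof.
transitivity (\sum_(i < n) \sum_a F (i, a)).
  by rewrite pair_bigA; apply: eq_bigr => -[].
apply: eq_bigr => i _.
rewrite (bigD1 None) //=; congr (_ + _).
rewrite (reindex_omap Some id) /=; last by case.
by apply: eq_bigl => b; rewrite eqxx.
Qed.

(** A hub selected together with all its pendant vertices has degree larger than [k]. *)
Lemma alpha_brush : (alpha (caterpillar_forest k) brush <= n * k.+1)%N.
Proof.
apply: alpha_le => S [_ dS _].
have -> : #|S| = (\sum_(i < n) #|[set a | (i, a) \in S]|)%N.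
  rewrite -sum1_card (eq_bigl (fun x : brush => (x.1, x.2) \in S)); last by case.
  rewrite -(pair_big_dep xpredT (fun i a => (i, a) \in S) (fun _ _ => 1%N)) /=.
  by apply: eq_bigr => i _; rewrite sum1dep_card.
apply: leq_trans (_ : \sum_(i < n) k.+1 <= _)%N; last by rewrite sum_nat_const card_ord.
apply: leq_sum => i _; rewrite leqNgt; apply/negP => big.
have full : [set a | (i, a) \in S] = setT.
  by apply/eqP; rewrite eqEcard subsetT cardsT card_option card_ord.
have mem a : (i, a) \in S by have := in_setT a; rewrite -full inE.
have := dS (exist _ (i, None) (mem None)).
rewrite deg_degin degin_induced leqNgt => /negP; apply.
apply: leq_trans (_ : #|[set ((i, Some b) : brush) | b in [set: 'I_k.+1]]| <= _)%N.
  by rewrite card_imset ?cardsT ?card_ord // => ? ? [].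
apply/subset_leq_card/subsetP => _ /imsetP[b _ ->]; rewrite inE /= /brush_adj /= eqxx andbT.
by apply/imsetP; exists (exist _ (i, Some b) (mem (Some b))).
Qed.
End Brush.

Section Necessary.
Variables (R : realType) (k : nat).
Hypothesis k2 : (2 <= k)%N.

Lemma lower_bound_le_complete (h : nat -> R) d : alpha_lower_bound (caterpillar_forest k) h ->
  h d <= 2 / d.+1%:R.
Proof.
move=> [_ hb]; rewrite ler_pdivlMr //.
have := hb (complete d.+1); rewrite (eq_bigr (fun=> h d)); last by move=> v _; rewrite deg_complete.
rewrite sumr_const card_ord -[h d *+ _]mulr_natr => H; apply: le_trans H _.
by rewrite ler_nat alpha_complete.
Qed.

(** With [n = d - k] hubs, each hub has degree [(n - 1) + (k + 1) = d]. *)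
Lemma lower_bound_le_brush (h : nat -> R) d : alpha_lower_bound (caterpillar_forest k) h ->
  (k < d)%N -> h d <= k.+1%:R * (1 - h 1%N).
Proof.
move=> [_ hb] kd; have n0 : (0 < d - k)%N by rewrite subn_gt0.
have := hb (brush (d - k) k); rewrite sum_brush.
rewrite (eq_bigr (fun=> h d + k.+1%:R * h 1%N)); last first.
  move=> i _; rewrite deg_hub; congr (h _ + _); first by lia.
  by rewrite (eq_bigr (fun=> h 1%N)) ?sumr_const ?card_ord ?mulr_natl // => b _; rewrite deg_bristle.
rewrite sumr_const card_ord -[(_ + _) *+ _]mulr_natl => H.
have {H} : (d - k)%:R * (h d + k.+1%:R * h 1%N) <= (d - k)%:R * k.+1%:R.
  by apply: le_trans H _; rewrite -natrM ler_nat alpha_brush.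
by rewrite ler_pM2l ?ltr0n // mulrBr mulr1 lerBrDr.
Qed.

Definition eps_max : R := 2 / (k.+1%:R * k.+2%:R).

Lemma eps_maxE : k.+1%:R * eps_max = 2 / k.+2%:R.
Proof.
have h1 : k.+1%:R != 0 :> R by rewrite pnatr_eq0.
have h2 : k.+2%:R != 0 :> R by rewrite pnatr_eq0.
by rewrite /eps_max; move: (k.+1%:R) (k.+2%:R) h1 h2 => x y h1 h2; field; rewrite h1 h2.
Qed.

Lemma eps_max_gt0 : 0 < eps_max.
Proof. by rewrite divr_gt0 // mulr_gt0 ?ltr0n. Qed.

Lemma eps_max_le1 : eps_max <= 1.
Proof. by rewrite ler_pdivrMr ?mulr_gt0 ?ltr0n // mul1r -natrM ler_nat; move: k2; case: k => [|[]]. Qed.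

Lemma lower_bound_dominated (h : nat -> R) : alpha_lower_bound (caterpillar_forest k) h ->
  exists2 eps : R, 0 <= eps <= eps_max & dominated h (fkeps k eps).
Proof.
move=> hb; have [u _] := hb; have /andP[h0 h1] := u 1%N.
exists (Num.min (1 - h 1%N) eps_max).
  by rewrite ge_min lexx orbT andbT le_min subr_ge0 h1 ltW // eps_max_gt0.
move=> d; rewrite /fkeps; case: eqP => [->|d0]; first by case/andP: (u 0%N).
case: eqP => [->|d1].
  by rewrite lerBrDr -lerBrDl ge_min lexx.
have hd := lower_bound_le_complete h d hb.
case: leqP => [//|kd]; rewrite le_min hd andbT.
rewrite minr_pMr // le_min (lower_bound_le_brush h d hb kd) eps_maxE.
by apply: le_trans hd _; apply: ler_frac; rewrite ?ler_nat.
Qed.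

Lemma fkeps_lower_bound eps : 0 <= eps <= eps_max ->
  alpha_lower_bound (caterpillar_forest k) (fkeps k eps).
Proof.
move=> /andP[e0 e1]; split; last by move=> G; apply: fkeps_sum.
move=> d; rewrite fkeps_le1 // andbT /fkeps; do ! case: ifP => _ //.
- by rewrite subr_ge0 (le_trans e1 eps_max_le1).
- by rewrite divr_ge0.
by rewrite le_min mulr_ge0 //= divr_ge0.
Qed.

(** If [fkeps k eps + g] is a lower bound, it is dominated by some [fkeps k e'].  The values
    at 1 give [e' <= eps], those at [k+1] give [eps <= e'], and so [g] vanishes. *)
Lemma fkeps_extremal eps : 0 <= eps <= eps_max ->
  extremal_alpha_lower_bound (caterpillar_forest k) (fkeps k eps).
Proof.
move=> he; split; first exact: fkeps_lower_bound.
move=> [g [ug [d gd] hb]]; have [e' /andP[e0' e1'] dom] := lower_bound_dominated _ hb.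
have /andP[e0 e1] := he.
have g0 i : 0 <= g i by case/andP: (ug i).
have le i : fkeps k eps i <= fkeps k e' i.
  by apply: le_trans (dom i); rewrite lerDl.
have h1 : e' <= eps.
  by have := le 1%N; rewrite /fkeps /= => h; rewrite -lerN2 -(lerD2l 1).
have h2 : eps <= e'.
  have := le k.+1; rewrite !fkeps_big // !min_l.
  - by rewrite ler_pM2l ?ltr0n.
  - by rewrite -eps_maxE ler_wpM2l.
  by rewrite -eps_maxE ler_wpM2l.
have E : e' = eps by apply/eqP; rewrite eq_le h1 h2.
by apply: gd; apply/eqP; rewrite eq_le g0 andbT; have := dom d; rewrite E gerDl.
Qed.

End Necessary.

Theorem theorem8 (R : realType) (k : nat) (hk : (2 <= k)%N) :
  (forall eps : R, 0 <= eps <= 2 / (k.+1%:R * k.+2%:R) ->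
     extremal_alpha_lower_bound (caterpillar_forest k) (fkeps k eps)) /\
  (forall f : nat -> R, alpha_lower_bound (caterpillar_forest k) f ->
     exists2 eps : R, 0 <= eps <= 2 / (k.+1%:R * k.+2%:R) &
       dominated f (fkeps k eps)).
Proof.
split; first by move=> eps; apply: fkeps_extremal.
by move=> f; apply: lower_bound_dominated.
Qed.
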